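(* For any relatively prime positive integers $p,q$ and any integer $k>1$, the $k$-times covered stationary lagrangian $(p,q)$ cone in $\mathbb R^4$ is strictly unstable. This is true for lagrangian variations fixing a neighborhood of the cone vertex; that is, there is a smooth compactly supported lagrangian variation of the $k$-times covered cone, fixing a neighborhood of the vertex, for which the second variation of area is strictly negative.
   Context: $\mathbb R^4=\mathbb C^2$ with its standard metric, complex structure and symplectic form. The $k$-times covered $(p,q)$ cone is the cone parametrized by $$\frac1{\sqrt{p+q}}\Big(r\sqrt q\,e^{i\sqrt{p/q}\,s},\ i\,r\sqrt p\,e^{-i\sqrt{q/p}\,s}\Big),\qquad 0\le s\le 2k\pi\sqrt{pq},\quad 0\le r<\infty,$$ with $s$ taken modulo $2k\pi\sqrt{pq}$ (so variations are given by functions of $(r,s)$ periodic in $s$ with this period, not necessarily descending to the singly covered cone). It is lagrangian and hamiltonian stationary, i.e. its area is critical for compactly supported hamiltonian variations. A lagrangian variation is a smooth one-parameter family of lagrangian surfaces through the given one.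
   Formalization: The case p = q = 1 is excluded by assuming p ≠ q: there the cone is a lagrangian plane, which is calibrated, so no compactly supported lagrangian variation of its k-fold cover has negative second variation and the claim fails. *)

(* Defs.v *)
From Stdlib Require Import Reals.
From Coquelicot Require Import Coquelicot.
Open Scope R_scope.

Definition C2 : Type := (C * C)%type.

Definition inner (u v : C2) : R :=
  Re (fst u) * Re (fst v) + Im (fst u) * Im (fst v)
  + Re (snd u) * Re (snd v) + Im (snd u) * Im (snd v).

Definition Jmul (u : C2) : C2 := (Cmult Ci (fst u), Cmult Ci (snd u)).

(** With this sign convention [omega] is dx1 /\ dy1 + dx2 /\ dy2. *)
Definition omega (u v : C2) : R := inner (Jmul u) v.

(** [Cn n D f]: on the set [D] (open in every use below), [f] has all partial
    derivatives of order at most [n], and they are continuous. *)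
Fixpoint Cn (n : nat) (D : R -> R -> R -> Prop) (f : R -> R -> R -> R) : Prop :=
  match n with
  | O => forall t r s, D t r s ->
      continuous (fun x : R * R * R => f (fst (fst x)) (snd (fst x)) (snd x))
                 (t, r, s)
  | S m =>
      (forall t r s, D t r s ->
         ex_derive (fun t' => f t' r s) t /\
         ex_derive (fun r' => f t r' s) r /\
         ex_derive (fun s' => f t r s') s) /\
      Cn m D (fun t r s => Derive (fun t' => f t' r s) t) /\
      Cn m D (fun t r s => Derive (fun r' => f t r' s) r) /\
      Cn m D (fun t r s => Derive (fun s' => f t r s') s)
  end.

Definition smooth_on (D : R -> R -> R -> Prop) (F : R -> R -> R -> C2) : Prop :=
  forall n,
    Cn n D (fun t r s => Re (fst (F t r s))) /\
    Cn n D (fun t r s => Im (fst (F t r s))) /\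
    Cn n D (fun t r s => Re (snd (F t r s))) /\
    Cn n D (fun t r s => Im (snd (F t r s))).

Definition Derive_C2 (g : R -> C2) (x : R) : C2 :=
  ((Derive (fun y => Re (fst (g y))) x, Derive (fun y => Im (fst (g y))) x),
   (Derive (fun y => Re (snd (g y))) x, Derive (fun y => Im (snd (g y))) x)).

Definition d_r (G : R -> R -> C2) (r s : R) : C2 := Derive_C2 (fun r' => G r' s) r.
Definition d_s (G : R -> R -> C2) (r s : R) : C2 := Derive_C2 (fun s' => G r s') s.

Definition gram (G : R -> R -> C2) (r s : R) : R :=
  inner (d_r G r s) (d_r G r s) * inner (d_s G r s) (d_s G r s)
  - (inner (d_r G r s) (d_s G r s)) ^ 2.

Definition immersed_at (G : R -> R -> C2) (r s : R) : Prop := 0 < gram G r s.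

Definition lagrangian_at (G : R -> R -> C2) (r s : R) : Prop :=
  omega (d_r G r s) (d_s G r s) = 0.

(** Area (with multiplicity) of the image of [a, b] x [0, T]. *)
Definition area (G : R -> R -> C2) (a b T : R) : R :=
  RInt (fun s => RInt (fun r => sqrt (gram G r s)) a b) 0 T.

Definition cis (x : R) : C := (cos x, sin x).

Definition cone (p q : nat) (r s : R) : C2 :=
  let P := INR p in
  let Q := INR q in
  (Cmult (RtoC (/ sqrt (P + Q) * (r * sqrt Q))) (cis (sqrt (P / Q) * s)),
   Cmult (RtoC (/ sqrt (P + Q) * (r * sqrt P))) (Cmult Ci (cis (- (sqrt (Q / P) * s))))).

(** The covering number [k] enters only through the period of [s]. *)
Definition cone_period (p q k : nat) : R :=
  2 * INR k * PI * sqrt (INR p * INR q).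

(** Smooth lagrangian variations [F t], [|t| < eps], of the k-times covered
    cone whose support lies in [a <= r <= b]; the vertex is [r = 0]. *)
Record lagrangian_variation (p q k : nat) (eps a b : R)
    (F : R -> R -> R -> C2) : Prop := {
  lv_eps : 0 < eps;
  lv_annulus : 0 < a < b;
  lv_smooth : smooth_on (fun t r _ => - eps < t < eps /\ 0 < r) F;
  lv_periodic : forall t r s, - eps < t < eps -> 0 <= r ->
    F t r (s + cone_period p q k) = F t r s;
  lv_initial : forall r s, 0 <= r -> F 0 r s = cone p q r s;
  lv_fixed_near_vertex : forall t r s, - eps < t < eps -> 0 <= r <= a ->
    F t r s = cone p q r s;
  lv_fixed_near_infinity : forall t r s, - eps < t < eps -> b <= r ->
    F t r s = cone p q r s;
  lv_immersed : forall t r s, - eps < t < eps -> 0 < r -> immersed_at (F t) r s;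
  lv_lagrangian : forall t r s, - eps < t < eps -> 0 < r -> lagrangian_at (F t) r s
}.

(** Since [Derive] is total, differentiability of [A] near 0 is required too. *)
Definition is_second_variation (A : R -> R) (v : R) : Prop :=
  locally 0 (fun t => ex_derive A t) /\ is_derive_n A 2 0 v.

(** The area outside [a <= r <= b] does not depend on [t], so it is omitted. *)
Definition strictly_unstable_away_from_vertex (p q k : nat) : Prop :=
  exists (eps a b : R) (F : R -> R -> R -> C2),
    lagrangian_variation p q k eps a b F /\
    exists v : R,
      is_second_variation (fun t => area (F t) a b (cone_period p q k)) v /\ v < 0.

(* Main.v *)
Require Import Defs.
From Stdlib Require Import Reals Lra Lia ClassicalEpsilon.
From Coquelicot Require Import Coquelicot.
Open Scope R_scope.

(** Write [P], [Q] for the reals [p], [q].  In the symplectic coordinates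
    [I_j = |z_j|^2 / 2] and [theta_j = arg z_j] the cone is linear: [I] is
    proportional to [r^2 (Q, P)] and [theta] is [(a s, pi/2 - s/a)] with
    [a = sqrt (P/Q)].  Multiply the two actions by [1 + U] and [1 - U], and replace
    [s] by [s + H] and [s - H] in the two angles.  With [x = ln r], the surface
    stays lagrangian exactly when [U_x + 2 U + 2 H_s = 0], a linear equation,
    solved by [U = 2 nu t f sin (nu s)] and [H = t (2 f + f_x) cos (nu s)] for any
    radial function [f].  So there is an explicit family of lagrangian surfaces
    ([variation_lagrangian]), smooth in all variables if [f] is
    ([variation_smooth]), with an explicit area density ([variation_gram]).

    Its second derivative at [t = 0] is a quadratic form in [f]
    ([density_line_derive], [density_quad_modes]), and differentiation under the
    double integral is justified by [is_derive_double_RInt].  Take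
    [f = eta (x / L) / r] with a fixed bump function [eta].  After integrations by
    parts ([radial_RInt]) the second variation is a positive multiple of the
    integral of
    [M eta^2 + 2 K (1 + nu^2) eta'^2 / L^2 + K eta''^2 / L^4], where
    [K = 2 P Q / (P + Q)^2] and [M = K (1 + nu^2)^2 - 2 nu^2].  If [M < 0] this is
    negative for [L] large ([radial_energy_neg]).

    Periodicity forces [nu = m / (k sqrt (P Q))] with an integer [m], and [M < 0]
    when [m] lies strictly between [k p] and [k q] ([unstable_mode]).  Such an
    integer exists since [k |p - q| >= 2] ([intermediate_mode]). *)

(** * Smooth functions of one and of three real variables *)

(** [f] is smooth on [O]: it belongs to a class of functions which are
    differentiable on [O] with derivative again in the class.  This form avoids
    closed formulas for iterated derivatives. *)
Definition smooth1 (O : R -> Prop) (f : R -> R) : Prop :=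
  exists S : (R -> R) -> Prop, S f /\
    forall g, S g -> exists g', S g' /\ forall x, O x -> is_derive g x (g' x).

Lemma smooth1_derive O f : smooth1 O f ->
  exists f', smooth1 O f' /\ forall x, O x -> is_derive f x (f' x).
Proof.
  intros [S [Sf HS]].
  destruct (HS f Sf) as [f' [Sf' H]].
  exists f'; split; [exists S; split; assumption | exact H].
Qed.

(** Openness of a set given by a ternary predicate. *)
Definition open3 (D : R -> R -> R -> Prop) : Prop :=
  forall t r s, D t r s ->
    locally ((t, r, s) : R * R * R) (fun x => D (fst (fst x)) (snd (fst x)) (snd x)).

(** The functions obtained on [D] from constants and coordinates by sums,
    products and composition with smooth functions of one variable.  The class
    is stable under partial differentiation. *)
Inductive smooth3 (D : R -> R -> R -> Prop) : (R -> R -> R -> R) -> Prop :=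
| smooth3_const c : smooth3 D (fun _ _ _ => c)
| smooth3_t : smooth3 D (fun t _ _ => t)
| smooth3_r : smooth3 D (fun _ r _ => r)
| smooth3_s : smooth3 D (fun _ _ s => s)
| smooth3_plus f g : smooth3 D f -> smooth3 D g ->
    smooth3 D (fun t r s => f t r s + g t r s)
| smooth3_mult f g : smooth3 D f -> smooth3 D g ->
    smooth3 D (fun t r s => f t r s * g t r s)
| smooth3_comp O h f : smooth1 O h -> (forall t r s, D t r s -> O (f t r s)) ->
    smooth3 D f -> smooth3 D (fun t r s => h (f t r s))
| smooth3_ext f g : (forall t r s, D t r s -> f t r s = g t r s) ->
    smooth3 D f -> smooth3 D g.

Lemma open3_slices D : open3 D -> forall t r s, D t r s ->
  locally t (fun t' => D t' r s) /\ locally r (fun r' => D t r' s) /\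
  locally s (fun s' => D t r s').
Proof.
  intros HD t r s H.
  destruct (HD t r s H) as [e He].
  repeat split; exists e; intros y Hy.
  - apply (He (y, r, s)); repeat split; try apply ball_center; exact Hy.
  - apply (He (t, y, s)); repeat split; try apply ball_center; exact Hy.
  - apply (He (t, r, y)); repeat split; try apply ball_center; exact Hy.
Qed.

Lemma smooth3_partial D f : open3 D -> smooth3 D f ->
  exists ft fr fs, smooth3 D ft /\ smooth3 D fr /\ smooth3 D fs /\
    forall t r s, D t r s ->
      is_derive (fun t' => f t' r s) t (ft t r s) /\
      is_derive (fun r' => f t r' s) r (fr t r s) /\
      is_derive (fun s' => f t r s') s (fs t r s).
Proof.
  intros HD Hf.
  induction Hf as [c | | | | f g Hf IHf Hg IHg | f g Hf IHf Hg IHg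
                  | O h f Hh HO Hf IHf | f g Hfg Hf IHf].
  - exists (fun _ _ _ => 0), (fun _ _ _ => 0), (fun _ _ _ => 0).
    do 3 (split; [apply smooth3_const |]); intros t r s _; (split; [| split]); cbv beta; auto_derive; trivial.
  - exists (fun _ _ _ => 1), (fun _ _ _ => 0), (fun _ _ _ => 0).
    do 3 (split; [apply smooth3_const |]); intros t r s _; (split; [| split]); cbv beta; auto_derive; trivial.
  - exists (fun _ _ _ => 0), (fun _ _ _ => 1), (fun _ _ _ => 0).
    do 3 (split; [apply smooth3_const |]); intros t r s _; (split; [| split]); cbv beta; auto_derive; trivial.
  - exists (fun _ _ _ => 0), (fun _ _ _ => 0), (fun _ _ _ => 1).
    do 3 (split; [apply smooth3_const |]); intros t r s _; (split; [| split]); cbv beta; auto_derive; trivial.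
  - destruct IHf as (ft & fr & fs & Sft & Sfr & Sfs & If).
    destruct IHg as (gt & gr & gs & Sgt & Sgr & Sgs & Ig).
    exists (fun t r s => ft t r s + gt t r s), (fun t r s => fr t r s + gr t r s),
      (fun t r s => fs t r s + gs t r s).
    do 3 (split; [apply smooth3_plus; assumption |]).
    intros t r s H; destruct (If t r s H) as (? & ? & ?), (Ig t r s H) as (? & ? & ?).
    (split; [| split]); apply @is_derive_plus; assumption.
  - destruct IHf as (ft & fr & fs & Sft & Sfr & Sfs & If).
    destruct IHg as (gt & gr & gs & Sgt & Sgr & Sgs & Ig).
    exists (fun t r s => ft t r s * g t r s + f t r s * gt t r s),
      (fun t r s => fr t r s * g t r s + f t r s * gr t r s),
      (fun t r s => fs t r s * g t r s + f t r s * gs t r s).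
    do 3 (split; [apply smooth3_plus; apply smooth3_mult; assumption |]).
    intros t r s H; destruct (If t r s H) as (? & ? & ?), (Ig t r s H) as (? & ? & ?).
    (split; [| split]);
      match goal with |- is_derive (fun x => @?F x * @?G x) _ _ =>
        apply (is_derive_mult F G) end; try assumption; intros; apply Rmult_comm.
  - destruct IHf as (ft & fr & fs & Sft & Sfr & Sfs & If).
    destruct (smooth1_derive O h Hh) as (h' & Sh' & Dh).
    exists (fun t r s => ft t r s * h' (f t r s)),
      (fun t r s => fr t r s * h' (f t r s)),
      (fun t r s => fs t r s * h' (f t r s)).
    do 3 (split; [apply smooth3_mult; [assumption |];
                  now apply (smooth3_comp D O) |]).
    intros t r s H; destruct (If t r s H) as (? & ? & ?).
    (split; [| split]); apply (is_derive_comp h); auto.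
  - destruct IHf as (ft & fr & fs & Sft & Sfr & Sfs & If).
    exists ft, fr, fs. do 3 (split; [assumption |]).
    intros t r s H; destruct (If t r s H) as (? & ? & ?).
    destruct (open3_slices D HD t r s H) as (Lt & Lr & Ls).
    (split; [| split]); eapply is_derive_ext_loc; try eassumption; cbv beta;
      match goal with L : locally ?x ?P |- locally ?x _ =>
        apply (filter_imp P); [intros; apply Hfg; assumption | exact L] end.
Qed.

Lemma smooth3_continuous D f : open3 D -> smooth3 D f -> forall t r s, D t r s ->
  continuous (fun x : R * R * R => f (fst (fst x)) (snd (fst x)) (snd x)) (t, r, s).
Proof.
  intros HD Hf.
  induction Hf as [c | | | | f g Hf IHf Hg IHg | f g Hf IHf Hg IHg
                  | O h f Hh HO Hf IHf | f g Hfg Hf IHf]; intros t r s H.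
  - apply continuous_const.
  - apply (continuous_comp fst fst); apply continuous_fst.
  - apply (continuous_comp fst snd); [apply continuous_fst | apply continuous_snd].
  - apply continuous_snd.
  - apply @continuous_plus; auto.
  - apply @continuous_mult; auto.
  - apply (continuous_comp (fun x : R * R * R => f (fst (fst x)) (snd (fst x)) (snd x)) h);
      [now apply IHf |].
    destruct (smooth1_derive O h Hh) as (h' & _ & Dh).
    apply @ex_derive_continuous. exists (h' (f t r s)). apply Dh. apply HO. exact H.
  - apply (continuous_ext_loc _ (fun x : R * R * R => f (fst (fst x)) (snd (fst x)) (snd x))).
    + eapply filter_imp; [| exact (HD t r s H)].
      intros x Hx; apply Hfg; exact Hx.
    + now apply IHf.
Qed.

Lemma smooth3_Cn D f n : open3 D -> smooth3 D f -> Cn n D f.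
Proof.
  intros HD; revert f; induction n as [| n IH]; intros f Hf.
  - intros t r s H; now apply (smooth3_continuous D f).
  - destruct (smooth3_partial D f HD Hf) as (ft & fr & fs & Sft & Sfr & Sfs & Df).
    simpl; split; [| split; [| split]].
    + intros t r s H; destruct (Df t r s H) as (? & ? & ?).
      repeat split; eexists; eassumption.
    + apply IH, (smooth3_ext D ft); [| exact Sft].
      intros t r s H; symmetry; apply is_derive_unique, Df, H.
    + apply IH, (smooth3_ext D fr); [| exact Sfr].
      intros t r s H; symmetry; apply is_derive_unique, Df, H.
    + apply IH, (smooth3_ext D fs); [| exact Sfs].
      intros t r s H; symmetry; apply is_derive_unique, Df, H.
Qed.

Lemma smooth1_trig : smooth1 (fun _ => True) cos /\ smooth1 (fun _ => True) sin.
Proof.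
  assert (Hstep : forall g, (exists a b, g = fun x => a * cos x + b * sin x) ->
    exists g', (exists a b, g' = fun x => a * cos x + b * sin x) /\
      forall x, True -> is_derive g x (g' x)).
  { intros g (a & b & ->).
    exists (fun x => b * cos x + (- a) * sin x); split; [now exists b, (- a) |].
    intros x _; auto_derive; [trivial | ring]. }
  assert (Hsub : forall f : R -> R, (exists a b, forall x, f x = a * cos x + b * sin x) ->
    smooth1 (fun _ => True) f).
  { intros f (a & b & Hf).
    exists (fun g => g = f \/ exists a b, g = fun x => a * cos x + b * sin x).
    split; [now left |].
    intros g [-> | Hg].
    - destruct (Hstep (fun x => a * cos x + b * sin x)) as (g' & Sg' & Dg'); [now exists a, b |].
      exists g'; split; [now right |]. intros x Hx.
      apply (is_derive_ext (fun x => a * cos x + b * sin x));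
        [intros; symmetry; apply Hf | now apply Dg'].
    - destruct (Hstep g Hg) as (g' & Sg' & Dg').
      exists g'; split; [now right | exact Dg']. }
  split; apply Hsub; [exists 1, 0 | exists 0, 1]; intros; ring.
Qed.

Lemma smooth1_inv : smooth1 (fun x => 0 < x) Rinv.
Proof.
  exists (fun g => g = Rinv \/ exists c n, g = fun x => c * / x ^ n).
  split; [now left |].
  intros g [-> | (c & n & ->)].
  - exists (fun x => (-1) * / x ^ 2); split; [right; now exists (-1), 2%nat |].
    intros x Hx; auto_derive; [lra | field; lra].
  - exists (fun x => (- c * INR n) * / x ^ S n); split; [right; now exists (- c * INR n), (S n) |].
    intros x Hx; auto_derive.
    + apply pow_nonzero; lra.
    + destruct n as [| n]; [simpl; field; lra |].
      change (Init.Nat.pred (S n)) with n.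
      assert (Hn : x ^ n <> 0) by (apply pow_nonzero; lra).
      simpl pow; field; split; assumption || lra.
Qed.

Lemma smooth1_ln : smooth1 (fun x => 0 < x) ln.
Proof.
  destruct smooth1_inv as (S & S0 & HS).
  exists (fun g => g = ln \/ S g); split; [now left |].
  intros g [-> | Hg].
  - exists Rinv; split; [now right | intros; now apply is_derive_ln].
  - destruct (HS g Hg) as (g' & ? & ?); exists g'; split; [now right | assumption].
Qed.

Lemma smooth1_sqrt : smooth1 (fun x => 0 < x) sqrt.
Proof.
  assert (Hstep : forall c n x, 0 < x -> is_derive (fun x => c * sqrt x / x ^ n) x
                    ((c * (/ 2 - INR n)) * sqrt x / x ^ S n)).
  { intros c n x Hx.
    assert (Hs : 0 < sqrt x) by now apply sqrt_lt_R0.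
    assert (Hsx : sqrt x * sqrt x = x) by (apply sqrt_sqrt; lra).
    assert (Hn : x ^ n <> 0) by (apply pow_nonzero; lra).
    auto_derive; [repeat split; trivial; lra |].
    assert (E : / (2 * sqrt x) = sqrt x / (2 * (sqrt x * sqrt x))) by (field; lra).
    rewrite Hsx in E.
    rewrite Rmult_1_l, E.
    destruct n as [| n]; [simpl; field; lra |].
    assert (Hn' : x ^ n <> 0) by (apply pow_nonzero; lra).
    change (Init.Nat.pred (S n)) with n.
    change (x ^ S n) with (x * x ^ n); change (x ^ S (S n)) with (x * (x * x ^ n)).
    field; split; lra. }
  exists (fun g => g = sqrt \/ exists c n, g = fun x => c * sqrt x / x ^ n).
  split; [now left |].
  intros g [-> | (c & n & ->)].
  - exists (fun x => (1 * (/ 2 - INR 0)) * sqrt x / x ^ 1); split; [right; now eexists _, _ |].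
    intros x Hx. apply (is_derive_ext (fun x => 1 * sqrt x / x ^ 0)).
    + intros; simpl; field.
    + now apply Hstep.
  - eexists; split; [right; now eexists _, _ |]. intros x Hx; now apply Hstep.
Qed.

(** * Smooth cut-off functions *)

(** [expinv m x] is [x^(-m) exp (-1/x)] for [x > 0], extended by zero; these
    functions span a class stable under differentiation. *)
Definition expinv (m : nat) (x : R) : R :=
  if Rlt_dec 0 x then (/ x) ^ m * exp (- / x) else 0.

Lemma expinv_pos m x : 0 < x -> expinv m x = (/ x) ^ m * exp (- / x).
Proof. intros H; unfold expinv; destruct (Rlt_dec 0 x); [reflexivity | lra]. Qed.

Lemma expinv_nonpos m x : x <= 0 -> expinv m x = 0.
Proof. intros H; unfold expinv; destruct (Rlt_dec 0 x); [lra | reflexivity]. Qed.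

Lemma expinv_bounded m : exists K, 0 <= K /\ forall x, 0 <= expinv m x <= K.
Proof.
  set (n := S m).
  assert (HN : 0 < INR n) by (apply lt_0_INR; unfold n; lia).
  assert (HNn : 0 < INR n ^ n) by now apply pow_lt.
  exists (1 + INR n ^ n); split; [lra |].
  intros x; destruct (Rle_dec x 0) as [Hx | Hx]; [rewrite expinv_nonpos; lra |].
  assert (Hz : 0 < / x) by (apply Rinv_0_lt_compat; lra).
  rewrite expinv_pos by lra.
  set (z := / x) in *.
  assert (He : 0 < exp (- z)) by apply exp_pos.
  assert (Hzm : 0 < z ^ m) by now apply pow_lt.
  split; [apply Rmult_le_pos; lra |].
  (* z^m <= 1 + z^n, and exp z = (exp (z/n))^n >= (z/n)^n *)
  assert (Hzn : z ^ m <= 1 + z ^ n).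
  { destruct (Rle_dec z 1) as [H1 | H1].
    - assert (z ^ m <= 1 ^ m) by (apply pow_incr; lra).
      assert (0 < z ^ n) by now apply pow_lt.
      rewrite pow1 in *; lra.
    - assert (z ^ m <= z ^ n) by (apply Rle_pow; [lra | unfold n; lia]). lra. }
  assert (Hexp : z ^ n * exp (- z) <= INR n ^ n).
  { assert (E : exp z = exp (z / INR n) ^ n).
    { clear -HN. assert (forall j y, exp (INR j * y) = exp y ^ j).
      { intros j y; induction j as [| j IH]; [now rewrite Rmult_0_l, exp_0 |].
        rewrite S_INR, Rmult_plus_distr_r, Rmult_1_l, exp_plus, IH; simpl; ring. }
      rewrite <- H; f_equal; field; lra. }
    assert (Hb : (z / INR n) ^ n <= exp z).
    { rewrite E; apply pow_incr.
      assert (0 <= z / INR n) by (apply Rdiv_le_0_compat; lra).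
      pose proof (exp_ineq1_le (z / INR n)); lra. }
    assert (E2 : z ^ n = INR n ^ n * (z / INR n) ^ n)
      by (rewrite <- Rpow_mult_distr; f_equal; field; lra).
    rewrite E2, Rmult_assoc.
    rewrite <- (Rmult_1_r (INR n ^ n)) at 2.
    apply Rmult_le_compat_l; [lra |].
    replace 1 with (exp z * exp (- z)) by (rewrite <- exp_plus, Rplus_opp_r; apply exp_0).
    apply Rmult_le_compat_r; lra. }
  assert (He1 : exp (- z) <= 1) by (left; rewrite <- exp_0; apply exp_increasing; lra).
  apply Rle_trans with ((1 + z ^ n) * exp (- z)); [apply Rmult_le_compat_r; lra |].
  lra.
Qed.

Lemma is_derive_expinv m x :
  is_derive (expinv m) x (- INR m * expinv (S m) x + expinv (S (S m)) x).
Proof.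
  destruct (Rtotal_order x 0) as [Hx | [-> | Hx]].
  - rewrite !expinv_nonpos by lra.
    apply (is_derive_ext_loc (fun _ => 0)).
    + exists (mkposreal (- x) ltac:(lra)); intros y Hy.
      change (Rabs (y - x) < - x) in Hy.
      symmetry; apply expinv_nonpos; apply Rabs_def2 in Hy; lra.
    + auto_derive; [trivial | ring].
  - rewrite !expinv_nonpos by lra.
    (* |expinv m h| <= K h^2 near 0 *)
    destruct (expinv_bounded (S (S m))) as (K & HK & HKb).
    apply is_derive_Reals.
    intros e He.
    assert (Hd : 0 < e / (K + 1)) by (apply Rdiv_lt_0_compat; lra).
    exists (mkposreal _ Hd); intros h Hh0 Hh; simpl in Hh.
    rewrite (expinv_nonpos m 0), Rplus_0_l by lra.
    replace ((expinv m h - 0) / h - (- INR m * 0 + 0)) with (expinv m h / h) by (field; lra).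
    destruct (Rle_dec h 0) as [Hn | Hp].
    + rewrite expinv_nonpos by lra. unfold Rdiv; rewrite Rmult_0_l, Rabs_R0; lra.
    + assert (E : expinv m h / h = h * expinv (S (S m)) h).
      { rewrite !expinv_pos by lra; simpl; field; lra. }
      rewrite E. destruct (HKb h) as [H1 H2].
      rewrite Rabs_mult, (Rabs_right (expinv _ h)) by lra.
      apply Rle_lt_trans with (Rabs h * (K + 1));
        [apply Rmult_le_compat_l; [apply Rabs_pos | lra] |].
      apply (Rmult_lt_compat_r (K + 1)) in Hh; [| lra].
      replace (e / (K + 1) * (K + 1)) with e in Hh by (field; lra). exact Hh.
  - rewrite !expinv_pos by lra.
    apply (is_derive_ext_loc (fun x => (/ x) ^ m * exp (- / x))).
    + exists (mkposreal x Hx); intros y Hy.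
      change (Rabs (y - x) < x) in Hy.
      symmetry; apply expinv_pos; apply Rabs_def2 in Hy; lra.
    + auto_derive; [repeat split; trivial; lra |].
      destruct m as [| m]; [simpl; field; lra |].
      change (Init.Nat.pred (S m)) with m. rewrite S_INR.
      simpl pow; field; lra.
Qed.

(** The linear span of the functions [expinv m]. *)
Inductive expinv_span : (R -> R) -> Prop :=
| expinv_span_base m : expinv_span (expinv m)
| expinv_span_plus f g : expinv_span f -> expinv_span g -> expinv_span (fun x => f x + g x)
| expinv_span_scal c f : expinv_span f -> expinv_span (fun x => c * f x).

Lemma smooth1_expinv m : smooth1 (fun _ => True) (expinv m).
Proof.
  exists expinv_span; split; [constructor |].
  intros g Hg; induction Hg as [n | f g _ (f' & Sf & Df) _ (g' & Sg & Dg) | c f _ (f' & Sf & Df)].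
  - exists (fun x => - INR n * expinv (S n) x + expinv (S (S n)) x); split.
    + apply expinv_span_plus; [apply expinv_span_scal |]; constructor.
    + intros; apply is_derive_expinv.
  - exists (fun x => f' x + g' x); split; [now apply expinv_span_plus |].
    intros; apply @is_derive_plus; auto.
  - exists (fun x => c * f' x); split; [now apply expinv_span_scal |].
    intros; apply @is_derive_scal; auto.
Qed.

(** * Integrals depending on parameters *)

(** Continuity at a compact set of points is uniform in a neighbourhood of the
    parameter value. *)
Lemma tube_estimate (U : UniformSpace) (f : U -> R -> R) (a b : R) (u0 : U) :
  (forall r, a <= r <= b ->
     continuous (fun x : U * R => f (fst x) (snd x)) (u0, r)) ->
  forall e, 0 < e ->
    locally u0 (fun u => forall r, a <= r <= b -> Rabs (f u r - f u0 r) <= e).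
Proof.
  intros Hc e He.
  assert (He2 : 0 < e / 2) by lra.
  assert (Hd : forall r, exists d : posreal, a <= r <= b -> forall u r',
            ball u0 d u -> ball r d r' -> Rabs (f u r' - f u0 r) < e / 2).
  { intros r. destruct (excluded_middle_informative (a <= r <= b)) as [Hr | Hr].
    - destruct (Hc r Hr _ (locally_ball (f u0 r) (mkposreal _ He2))) as [d Hd].
      exists d; intros _ u r' Hu Hr'. apply (Hd (u, r')). now split.
    - exists (mkposreal 1 Rlt_0_1); intros H; contradiction. }
  pose (delta := fun r => proj1_sig (constructive_indefinite_description _ (Hd r))).
  assert (Hdelta : forall r, a <= r <= b -> forall u r',
            ball u0 (delta r) u -> ball r (delta r) r' -> Rabs (f u r' - f u0 r) < e / 2).
  { intros r; unfold delta.
    now destruct (constructive_indefinite_description _ (Hd r)). }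
  destruct (compactness_value_1d a b delta) as [d Hcov].
  exists d; intros u Hu r Hr.
  apply Rnot_lt_le; intros Hlt; apply (Hcov r Hr).
  intros (x & Hx & Hrx & Hdx).
  assert (H1 : Rabs (f u r - f u0 x) < e / 2).
  { apply (Hdelta x Hx); [now apply ball_le with d | exact Hrx]. }
  assert (H2 : Rabs (f u0 r - f u0 x) < e / 2).
  { apply (Hdelta x Hx); [apply ball_center | exact Hrx]. }
  apply (Rlt_irrefl e); apply Rlt_le_trans with (1 := Hlt).
  replace (f u r - f u0 r) with ((f u r - f u0 x) - (f u0 r - f u0 x)) by ring.
  apply Rle_trans with (1 := Rabs_triang _ _); rewrite Rabs_Ropp; lra.
Qed.

Lemma continuous_RInt_param (U : UniformSpace) (f : U -> R -> R) (a b : R) (u0 : U) :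
  a <= b ->
  (forall r, a <= r <= b ->
     continuous (fun x : U * R => f (fst x) (snd x)) (u0, r)) ->
  locally u0 (fun u => ex_RInt (f u) a b) ->
  continuous (fun u => RInt (f u) a b) u0.
Proof.
  intros Hab Hc Hex.
  apply filterlim_locally; intros e.
  assert (He : 0 < e / (2 * (b - a + 1))) by (apply Rdiv_lt_0_compat; [apply cond_pos | lra]).
  pose proof (tube_estimate U f a b u0 Hc _ He) as Ht.
  generalize (filter_and _ _ Ht Hex); apply filter_imp.
  intros u [Hu Hexu].
  pose proof (locally_singleton _ _ Hex) as Hex0; cbv beta in Hex0.
  change (Rabs (RInt (f u) a b - RInt (f u0) a b) < e).
  replace (RInt (f u) a b - RInt (f u0) a b) with (RInt (fun r => f u r - f u0 r) a b)
    by exact (RInt_minus (V := R_CompleteNormedModule) (f u) (f u0) a b Hexu Hex0).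
  apply Rle_lt_trans with ((b - a) * (e / (2 * (b - a + 1)))).
  - apply abs_RInt_le_const; [exact Hab | now apply (ex_RInt_minus (V := R_NormedModule)) |].
    exact Hu.
  - pose proof (cond_pos e).
    apply Rle_lt_trans with ((b - a + 1) * (e / (2 * (b - a + 1)))).
    + apply Rmult_le_compat_r; lra.
    + replace ((b - a + 1) * (e / (2 * (b - a + 1)))) with (e / 2) by (field; lra). lra.
Qed.

(** The domain [|t| < eps], [r > 0]; the coordinate [s] is unrestricted. *)
Definition half_slab (eps t r : R) (s : R) : Prop := - eps < t < eps /\ 0 < r.

Lemma half_slab_open eps : open3 (half_slab eps).
Proof.
  intros t r s [Ht Hr].
  assert (Hd : 0 < Rmin r (Rmin (eps - t) (t + eps))) by (repeat apply Rmin_glb_lt; lra).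
  exists (mkposreal _ Hd); intros [[t' r'] s'] [[Bt Br] _]; simpl in *.
  change (Rabs (t' - t) < Rmin r (Rmin (eps - t) (t + eps))) in Bt.
  change (Rabs (r' - r) < Rmin r (Rmin (eps - t) (t + eps))) in Br.
  pose proof (Rmin_l r (Rmin (eps - t) (t + eps))).
  pose proof (Rmin_r r (Rmin (eps - t) (t + eps))).
  pose proof (Rmin_l (eps - t) (t + eps)).
  pose proof (Rmin_r (eps - t) (t + eps)).
  apply Rabs_def2 in Bt; apply Rabs_def2 in Br; unfold half_slab; lra.
Qed.

Section DoubleIntegral.

Variables (eps a b T : R).
Hypotheses (Ha : 0 < a) (Hab : a < b) (HT : 0 <= T).

Lemma locally_parameter (t : R) : - eps < t < eps -> locally t (fun t' => - eps < t' < eps).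
Proof.
  intros Ht.
  destruct (open3_slices _ (half_slab_open eps) t 1 0) as (H & _); [split; lra |].
  eapply filter_imp; [| exact H]; intros x Hx; apply Hx.
Qed.

Lemma smooth3_continuous_perm f t r s : smooth3 (half_slab eps) f ->
  - eps < t < eps -> 0 < r ->
  continuous (fun x : R * R * R => f (fst (fst x)) (snd x) (snd (fst x))) (t, s, r).
Proof.
  intros Hf Ht Hr P HP.
  destruct (smooth3_continuous _ f (half_slab_open eps) Hf t r s (conj Ht Hr) P HP) as [d Hd].
  exists d; intros [[t' s'] r'] [[Bt Bs] Br].
  apply (Hd (t', r', s')); repeat split; assumption.
Qed.

Lemma smooth3_continuous_tr f t r s : smooth3 (half_slab eps) f ->
  - eps < t < eps -> 0 < r ->
  continuous (fun x : R * R => f (fst x) (snd x) s) (t, r).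
Proof.
  intros Hf Ht Hr P HP.
  destruct (smooth3_continuous _ f (half_slab_open eps) Hf t r s (conj Ht Hr) P HP) as [d Hd].
  exists d; intros [t' r'] [Bt Br].
  apply (Hd (t', r', s)); repeat split; try assumption; apply ball_center.
Qed.

Lemma ex_RInt_inner f t s : smooth3 (half_slab eps) f -> - eps < t < eps ->
  ex_RInt (fun r => f t r s) a b.
Proof.
  intros Hf Ht.
  apply @ex_RInt_continuous; intros r; rewrite Rmin_left, Rmax_right by lra; intros Hr.
  apply (continuous_comp (fun r => (t, r)) (fun x : R * R => f (fst x) (snd x) s)).
  - apply (continuous_comp_2 (fun _ => t) (fun r => r) (fun t r => (t, r)));
      [apply continuous_const | apply continuous_id |].
    apply (continuous_ext (fun x => x)); [intros [? ?]; reflexivity | apply continuous_id].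
  - apply smooth3_continuous_tr; [assumption | lra | lra].
Qed.

Lemma continuous_inner f t s : smooth3 (half_slab eps) f -> - eps < t < eps ->
  continuous (fun x : R * R => RInt (fun r => f (fst x) r (snd x)) a b) (t, s).
Proof.
  intros Hf Ht.
  apply (continuous_RInt_param (prod_UniformSpace R_UniformSpace R_UniformSpace)
           (fun x r => f (fst x) r (snd x))); [lra | |].
  - intros r Hr; apply (smooth3_continuous_perm f); [assumption | lra | lra].
  - destruct (locally_parameter t Ht) as [d Hd].
    exists d; intros [t' s'] [Bt _]; apply ex_RInt_inner; [assumption | now apply Hd].
Qed.

Lemma ex_RInt_outer f t : smooth3 (half_slab eps) f -> - eps < t < eps ->
  ex_RInt (fun s => RInt (fun r => f t r s) a b) 0 T.
Proof.
  intros Hf Ht.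
  apply @ex_RInt_continuous; intros s _.
  apply (continuous_comp (fun s => (t, s))
           (fun x : R * R => RInt (fun r => f (fst x) r (snd x)) a b)).
  - apply (continuous_comp_2 (fun _ => t) (fun r => r) (fun t r => (t, r)));
      [apply continuous_const | apply continuous_id |].
    apply (continuous_ext (fun x => x)); [intros [? ?]; reflexivity | apply continuous_id].
  - now apply continuous_inner.
Qed.

Lemma is_derive_inner f ft t s :
  smooth3 (half_slab eps) f -> smooth3 (half_slab eps) ft ->
  (forall t r s, half_slab eps t r s -> is_derive (fun t' => f t' r s) t (ft t r s)) ->
  - eps < t < eps ->
  is_derive (fun t' => RInt (fun r => f t' r s) a b) t (RInt (fun r => ft t r s) a b).
Proof.
  intros Hf Hft Df Ht.
  replace (RInt (fun r => ft t r s) a b)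
    with (RInt (fun r => Derive (fun t' => f t' r s) t) a b).
  2: { apply RInt_ext; intros r; rewrite Rmin_left, Rmax_right by lra; intros Hr.
       apply is_derive_unique, Df; split; lra. }
  apply (is_derive_RInt_param (fun t r => f t r s)).
  - generalize (locally_parameter t Ht); apply filter_imp; intros t' Ht' r.
    rewrite Rmin_left, Rmax_right by lra; intros Hr.
    exists (ft t' r s); apply Df; split; lra.
  - intros r; rewrite Rmin_left, Rmax_right by lra; intros Hr.
    apply continuity_2d_pt_filterlim.
    assert (Hr0 : 0 < r) by lra.
    cbv beta; rewrite (is_derive_unique (fun z : R => f z r s) _ _ (Df t r s (conj Ht Hr0))).
    apply (filterlim_ext_loc (fun x : R * R => ft (fst x) (snd x) s)).
    + destruct (half_slab_open eps t r s (conj Ht Hr0)) as [d Hd].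
      exists d; intros [t' r'] [Bt Br]; symmetry; apply is_derive_unique, Df.
      apply (Hd (t', r', s)); repeat split; try assumption; apply ball_center.
    + now apply smooth3_continuous_tr.
  - generalize (locally_parameter t Ht); apply filter_imp; intros t' Ht'.
    now apply ex_RInt_inner.
Qed.

(** Differentiation under the double integral sign. *)
Lemma is_derive_double_RInt f ft t :
  smooth3 (half_slab eps) f -> smooth3 (half_slab eps) ft ->
  (forall t r s, half_slab eps t r s -> is_derive (fun t' => f t' r s) t (ft t r s)) ->
  - eps < t < eps ->
  is_derive (fun t' => RInt (fun s => RInt (fun r => f t' r s) a b) 0 T) t
    (RInt (fun s => RInt (fun r => ft t r s) a b) 0 T).
Proof.
  intros Hf Hft Df Ht.
  assert (Di : forall t' s, - eps < t' < eps ->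
            Derive (fun t' => RInt (fun r => f t' r s) a b) t' = RInt (fun r => ft t' r s) a b)
    by (intros; apply is_derive_unique, is_derive_inner; assumption).
  replace (RInt (fun s => RInt (fun r => ft t r s) a b) 0 T)
    with (RInt (fun s => Derive (fun t' => RInt (fun r => f t' r s) a b) t) 0 T)
    by (apply RInt_ext; intros; now apply Di).
  apply (is_derive_RInt_param (fun t s => RInt (fun r => f t r s) a b)).
  - generalize (locally_parameter t Ht); apply filter_imp; intros t' Ht' s _.
    eexists; now apply (is_derive_inner f ft).
  - intros s _.
    apply continuity_2d_pt_filterlim; cbv beta; rewrite Di by assumption.
    apply (filterlim_ext_loc (fun x : R * R => RInt (fun r => ft (fst x) r (snd x)) a b)).
    + destruct (locally_parameter t Ht) as [d Hd].
      exists d; intros [t' s'] [Bt _]; symmetry; apply Di, Hd, Bt.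
    + exact (continuous_inner ft t s Hft Ht).
  - generalize (locally_parameter t Ht); apply filter_imp; intros t' Ht'.
    now apply ex_RInt_outer.
Qed.

End DoubleIntegral.

(** * Surfaces in polar coordinates *)

(** The tangent vector of the curve [(R1 e^(i T1), i R2 e^(i T2))] when the radii
    and angles have derivatives [R1'], [T1'], [R2'], [T2']. *)
Definition polar_tangent (R1 T1 R2 T2 R1' T1' R2' T2' : R) : C2 :=
  ((R1' * cos T1 - R1 * T1' * sin T1, R1' * sin T1 + R1 * T1' * cos T1),
   (- (R2' * sin T2) - R2 * T2' * cos T2, R2' * cos T2 - R2 * T2' * sin T2)).

Lemma Derive_C2_polar (R1 T1 R2 T2 : R -> R) (x R1' T1' R2' T2' : R) :
  is_derive R1 x R1' -> is_derive T1 x T1' ->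
  is_derive R2 x R2' -> is_derive T2 x T2' ->
  Derive_C2 (fun y => (Cmult (RtoC (R1 y)) (cis (T1 y)),
                       Cmult (RtoC (R2 y)) (Cmult Ci (cis (T2 y))))) x
  = polar_tangent (R1 x) (T1 x) (R2 x) (T2 x) R1' T1' R2' T2'.
Proof.
  intros H1 H2 H3 H4.
  assert (E1 : Derive (fun x : R => R1 x) x = R1') by exact (is_derive_unique _ _ _ H1).
  assert (E2 : Derive (fun x : R => T1 x) x = T1') by exact (is_derive_unique _ _ _ H2).
  assert (E3 : Derive (fun x : R => R2 x) x = R2') by exact (is_derive_unique _ _ _ H3).
  assert (E4 : Derive (fun x : R => T2 x) x = T2') by exact (is_derive_unique _ _ _ H4).
  unfold Derive_C2, polar_tangent.
  repeat (apply f_equal2); apply is_derive_unique; simpl;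
    (auto_derive; [repeat split; trivial; eexists; eassumption |]);
    rewrite ?E1, ?E2, ?E3, ?E4;
    ring.
Qed.

Lemma inner_polar_tangent R1 T1 R2 T2 a1 b1 a2 b2 c1 d1 c2 d2 :
  inner (polar_tangent R1 T1 R2 T2 a1 b1 a2 b2) (polar_tangent R1 T1 R2 T2 c1 d1 c2 d2)
  = a1 * c1 + R1 ^ 2 * b1 * d1 + a2 * c2 + R2 ^ 2 * b2 * d2.
Proof.
  unfold inner, polar_tangent; simpl.
  pose proof (sin2_cos2 T1) as H1; pose proof (sin2_cos2 T2) as H2.
  unfold Rsqr in H1, H2.
  transitivity ((a1 * c1 + R1 ^ 2 * b1 * d1) * (sin T1 * sin T1 + cos T1 * cos T1)
    + (a2 * c2 + R2 ^ 2 * b2 * d2) * (sin T2 * sin T2 + cos T2 * cos T2)); [ring |].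
  rewrite H1, H2; ring.
Qed.

Lemma omega_polar_tangent R1 T1 R2 T2 a1 b1 a2 b2 c1 d1 c2 d2 :
  omega (polar_tangent R1 T1 R2 T2 a1 b1 a2 b2) (polar_tangent R1 T1 R2 T2 c1 d1 c2 d2)
  = R1 * (a1 * d1 - c1 * b1) + R2 * (a2 * d2 - c2 * b2).
Proof.
  unfold omega, inner, polar_tangent; simpl.
  pose proof (sin2_cos2 T1) as H1; pose proof (sin2_cos2 T2) as H2.
  unfold Rsqr in H1, H2.
  transitivity (R1 * (a1 * d1 - c1 * b1) * (sin T1 * sin T1 + cos T1 * cos T1)
    + R2 * (a2 * d2 - c2 * b2) * (sin T2 * sin T2 + cos T2 * cos T2)); [ring |].
  rewrite H1, H2; ring.
Qed.

(** * The area density and its expansion *)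

(** The normalised area density of the deformed cone.  Here [c1], [c2] are the
    squared lengths of the two components of the cone at [r = 1], [u] is the
    relative change of the squared radii, [y] half its [s]-derivative, and [b],
    [w] are the derivatives of the angular shift in [s] and in [ln r].  The two
    squares come, up to a common factor, from the real and imaginary parts of the
    complex determinant of the tangent vectors, whose modulus is the area when the
    tangent plane is lagrangian. *)
Definition density_num (c1 c2 u b y w : R) : R :=
  c1 * (1 - u) * ((1 - b) ^ 2 + y * w) + c2 * (1 + u) * ((1 + b) ^ 2 + y * w).

Definition density (c1 c2 u b y w : R) : R :=
  (c1 * c2 * (2 * w * ((1 + u) * (1 - u)) - 2 * y) ^ 2 + density_num c1 c2 u b y w ^ 2)
  / ((1 + u) * (1 - u)).

(** The left-hand side is the Gram determinant computed from the three inner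
    products of the tangent vectors. *)
Lemma density_gram c1 c2 u b y w : c1 + c2 = 1 -> 1 + u <> 0 -> 1 - u <> 0 ->
  (c1 * (1 - b) ^ 2 / (1 + u) + c2 * (1 + b) ^ 2 / (1 - u)
     + w ^ 2 * (c2 * (1 + u) + c1 * (1 - u)))
  * (y ^ 2 * (c1 / (1 + u) + c2 / (1 - u))
     + c2 * (1 + u) * (1 + b) ^ 2 + c1 * (1 - u) * (1 - b) ^ 2)
  - (c1 * (1 - b) * y / (1 + u) - c2 * (1 + b) * y / (1 - u)
     + w * (c2 * (1 + u) * (1 + b) - c1 * (1 - u) * (1 - b))) ^ 2
  = density c1 c2 u b y w.
Proof.
  intros Hc Hp Hm; unfold density, density_num.
  replace c2 with (1 - c1) by lra.
  field; split; assumption.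
Qed.

Lemma density_pos c1 c2 u b y w : 0 < c1 -> 0 < c2 ->
  -1/4 < u < 1/4 -> -1/4 < b < 1/4 -> -1/4 < y < 1/4 -> -1/4 < w < 1/4 ->
  0 < density c1 c2 u b y w.
Proof.
  intros Hc1 Hc2 Hu Hb Hy Hw.
  assert (Hyw : - 1/16 <= y * w) by nra.
  assert (H1 : 0 < (1 - b) ^ 2 + y * w) by nra.
  assert (H2 : 0 < (1 + b) ^ 2 + y * w) by nra.
  assert (HN : 0 < density_num c1 c2 u b y w).
  { unfold density_num; apply Rplus_lt_0_compat; apply Rmult_lt_0_compat; trivial;
      apply Rmult_lt_0_compat; lra. }
  unfold density; apply Rdiv_lt_0_compat; [| apply Rmult_lt_0_compat; lra].
  apply Rplus_le_lt_0_compat; [| now apply pow_lt].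
  apply Rmult_le_pos; [| apply pow2_ge_0].
  apply Rmult_le_pos; lra.
Qed.

(** The coefficient of [t ^ 2] in the square root of the density along a line
    through the origin. *)
Definition density_quad (c1 c2 u b y w : R) : R :=
  b ^ 2 + 2 * u * b + u ^ 2 / 2 + y * w + 2 * c1 * c2 * (w - y) ^ 2.

(** The density along the line through the origin with direction [(u, b, y, w)]. *)
Definition density_line (c1 c2 u b y w t : R) : R :=
  density c1 c2 (t * u) (t * b) (t * y) (t * w).

(** The first derivative [d'] is only described through its derivative at [0];
    the second derivative of the root of the density at [0] is thus
    [2 density_quad]. *)
Lemma density_line_derive c1 c2 u b y w : c1 + c2 = 1 ->
  exists d' : R -> R,
    (forall t, 0 < density_line c1 c2 u b y w t -> (1 + t * u) * (1 - t * u) <> 0 ->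
       is_derive (fun t => sqrt (density_line c1 c2 u b y w t)) t (d' t)) /\
    is_derive d' 0 (2 * density_quad c1 c2 u b y w).
Proof.
  intros Hc.
  (* n is the expansion in t of density_num along the line *)
  pose (n := fun t => 1 + (c2 - c1) * (u + 2 * b) * t + (b ^ 2 + y * w + 2 * u * b) * t ^ 2
                 + (c2 - c1) * u * (b ^ 2 + y * w) * t ^ 3).
  pose (n' := fun t => (c2 - c1) * (u + 2 * b) + 2 * (b ^ 2 + y * w + 2 * u * b) * t
                 + 3 * ((c2 - c1) * u * (b ^ 2 + y * w)) * t ^ 2).
  pose (e := fun t => 2 * w * (1 - t ^ 2 * u ^ 2) - 2 * y).
  pose (D := fun t => (c1 * c2 * (t * e t) ^ 2 + n t ^ 2) / (1 - t ^ 2 * u ^ 2)).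
  pose (D' := fun t => (c1 * c2 * (2 * t * e t ^ 2 - t ^ 2 * e t * (8 * w * t * u ^ 2))
                   + 2 * n t * n' t) / (1 - t ^ 2 * u ^ 2)
                + D t * (2 * t * u ^ 2) / (1 - t ^ 2 * u ^ 2)).
  assert (HD : forall t, density_line c1 c2 u b y w t = D t).
  { intros t; unfold density_line, density, D, Rdiv; f_equal.
    - f_equal; [unfold e; ring |].
      f_equal. unfold density_num, n. replace c2 with (1 - c1) by lra. ring.
    - f_equal; ring. }
  assert (DD : forall t, 1 - t ^ 2 * u ^ 2 <> 0 -> is_derive D t (D' t)).
  { intros t Ht; unfold D', D, e, n, n'; auto_derive; [assumption |].
    field; rewrite Rpow_mult_distr; assumption. }
  assert (D0 : D 0 = 1) by (unfold D, e, n; field).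
  assert (Ds : forall t, 1 - t ^ 2 * u ^ 2 <> 0 -> 0 < D t ->
             is_derive (fun t => sqrt (D t)) t (D' t / (2 * sqrt (D t))))
    by (intros; apply is_derive_sqrt; auto).
  exists (fun t => D' t / (2 * sqrt (D t))); split.
  - intros t HDt Ht; rewrite HD in HDt.
    apply (is_derive_ext (fun t => sqrt (D t))); [intros; now rewrite HD |].
    apply Ds; [| exact HDt].
    intros E; apply Ht; rewrite <- E; ring.
  - assert (H0 : 1 - 0 ^ 2 * u ^ 2 <> 0) by (simpl; lra).
    assert (DD' : is_derive D' 0 (8 * c1 * c2 * (w - y) ^ 2
              + 2 * ((c2 - c1) * (u + 2 * b)) ^ 2 + 4 * (b ^ 2 + y * w + 2 * u * b) + 2 * u ^ 2)).
    { unfold D', D, e, n, n'; auto_derive; [repeat split; simpl; lra | field]. }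
    assert (Ds0 : is_derive (fun t => 2 * sqrt (D t)) 0 (D' 0)).
    { replace (D' 0) with (2 * (D' 0 / (2 * sqrt (D 0))))
        by (rewrite D0, sqrt_1; field).
      apply @is_derive_scal, Ds; [exact H0 | rewrite D0; lra]. }
    replace (2 * density_quad c1 c2 u b y w) with
      (((8 * c1 * c2 * (w - y) ^ 2 + 2 * ((c2 - c1) * (u + 2 * b)) ^ 2
         + 4 * (b ^ 2 + y * w + 2 * u * b) + 2 * u ^ 2) * (2 * sqrt (D 0))
        - D' 0 * D' 0) / (2 * sqrt (D 0)) ^ 2).
    + apply (is_derive_div D' (fun t => 2 * sqrt (D t)) 0 _ (D' 0)); [exact DD' | exact Ds0 | rewrite D0, sqrt_1; lra].
    + rewrite D0, sqrt_1; unfold density_quad, D', D, e, n, n'.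
      replace c2 with (1 - c1) by lra. field.
Qed.

(** * The cut-off profile *)

(** A smooth bump function supported in [[1, 2]], and its first two derivatives.
    The support lies in [y > 0] so that the profiles below vanish near [r = 0],
    and for [r <= 0] too, where [ln r] is [0]. *)
Definition eta (y : R) : R := expinv 0 (y - 1) * expinv 0 (2 - y).
Definition eta1 (y : R) : R :=
  expinv 2 (y - 1) * expinv 0 (2 - y) - expinv 0 (y - 1) * expinv 2 (2 - y).
Definition eta2 (y : R) : R :=
  (- 2 * expinv 3 (y - 1) + expinv 4 (y - 1)) * expinv 0 (2 - y)
  - 2 * (expinv 2 (y - 1) * expinv 2 (2 - y))
  + expinv 0 (y - 1) * (- 2 * expinv 3 (2 - y) + expinv 4 (2 - y)).

Lemma eta_outside y : y <= 1 \/ 2 <= y -> eta y = 0 /\ eta1 y = 0 /\ eta2 y = 0.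
Proof.
  intros H; unfold eta, eta1, eta2.
  destruct H as [H | H].
  - rewrite !(expinv_nonpos _ (y - 1)) by lra; repeat split; ring.
  - rewrite !(expinv_nonpos _ (2 - y)) by lra; repeat split; ring.
Qed.

Lemma eta_pos y : 1 < y < 2 -> 0 < eta y.
Proof.
  intros H; unfold eta; rewrite !expinv_pos by lra; simpl.
  rewrite !Rmult_1_l; apply Rmult_lt_0_compat; apply exp_pos.
Qed.

Lemma Derive_expinv m x :
  Derive (fun x => expinv m x) x = - INR m * expinv (S m) x + expinv (S (S m)) x.
Proof. apply (is_derive_unique (expinv m)), is_derive_expinv. Qed.

Lemma is_derive_eta y : is_derive eta y (eta1 y).
Proof.
  unfold eta, eta1.
  auto_derive; [repeat split; eexists; apply is_derive_expinv |].
  rewrite !Derive_expinv; simpl INR; unfold Rminus; ring.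
Qed.

Lemma is_derive_eta1 y : is_derive eta1 y (eta2 y).
Proof.
  unfold eta1, eta2.
  auto_derive; [repeat split; eexists; apply is_derive_expinv |].
  rewrite !Derive_expinv; simpl INR; unfold Rminus; ring.
Qed.

Lemma continuous_eta y : continuous eta y.
Proof. apply @ex_derive_continuous; eexists; apply is_derive_eta. Qed.

Lemma continuous_eta1 y : continuous eta1 y.
Proof. apply @ex_derive_continuous; eexists; apply is_derive_eta1. Qed.

Lemma continuous_eta2 y : continuous eta2 y.
Proof.
  apply @ex_derive_continuous; unfold eta2.
  auto_derive; repeat split; eexists; apply is_derive_expinv.
Qed.

Lemma eta_bounded : exists K, 0 <= K /\
  forall y, Rabs (eta y) <= K /\ Rabs (eta1 y) <= K /\ Rabs (eta2 y) <= K.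
Proof.
  destruct (expinv_bounded 0) as (K0 & P0 & B0).
  destruct (expinv_bounded 2) as (K2 & P2 & B2).
  destruct (expinv_bounded 3) as (K3 & P3 & B3).
  destruct (expinv_bounded 4) as (K4 & P4 & B4).
  pose (K := K0 + K2 + K3 + K4).
  assert (Hp : forall m n x y, expinv m x <= K -> expinv n y <= K ->
             0 <= expinv m x -> 0 <= expinv n y -> 0 <= expinv m x * expinv n y <= K * K)
    by (intros; split; [apply Rmult_le_pos | apply Rmult_le_compat]; assumption).
  assert (H0 : forall x, 0 <= expinv 0 x <= K) by (intros x; specialize (B0 x); unfold K; lra).
  assert (H2 : forall x, 0 <= expinv 2 x <= K) by (intros x; specialize (B2 x); unfold K; lra).
  assert (H3 : forall x, 0 <= expinv 3 x <= K) by (intros x; specialize (B3 x); unfold K; lra).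
  assert (H4 : forall x, 0 <= expinv 4 x <= K) by (intros x; specialize (B4 x); unfold K; lra).
  clear -Hp H0 H2 H3 H4.
  assert (Hm : forall m n x y, (forall x, 0 <= expinv m x <= K) -> (forall x, 0 <= expinv n x <= K) ->
      0 <= expinv m x * expinv n y <= K * K) by (intros; apply Hp; apply H || apply H1).
  clear Hp.
  exists (8 * (K * K)); split; [nra |].
  intros y; unfold eta, eta1, eta2.
  pose proof (Hm _ _ (y - 1) (2 - y) H0 H0). pose proof (Hm _ _ (y - 1) (2 - y) H2 H0).
  pose proof (Hm _ _ (y - 1) (2 - y) H0 H2). pose proof (Hm _ _ (y - 1) (2 - y) H3 H0).
  pose proof (Hm _ _ (y - 1) (2 - y) H4 H0). pose proof (Hm _ _ (y - 1) (2 - y) H2 H2).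
  pose proof (Hm _ _ (y - 1) (2 - y) H0 H3). pose proof (Hm _ _ (y - 1) (2 - y) H0 H4).
  split; [| split]; apply Rabs_le; lra.
Qed.

(** The radial profile [f = eta (ln r / L) / r] of the deformation, supported in
    [exp L <= r <= exp (2 L)], with [g = 2 f + r f'] and [k = r g']. *)
Definition prof_f (L r : R) : R := eta (ln r / L) / r.
Definition prof_g (L r : R) : R := (eta (ln r / L) + eta1 (ln r / L) / L) / r.
Definition prof_k (L r : R) : R := (eta2 (ln r / L) / L ^ 2 - eta (ln r / L)) / r.

Lemma is_derive_prof_f L r : 0 < L -> 0 < r ->
  is_derive (prof_f L) r ((prof_g L r - 2 * prof_f L r) / r).
Proof.
  intros HL Hr; unfold prof_f, prof_g.
  auto_derive.
  - repeat split; trivial; try lra. eexists; apply is_derive_eta.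
  - rewrite (is_derive_unique (fun x : R => eta x) _ _ (is_derive_eta _)).
    unfold Rdiv; field; lra.
Qed.

Lemma is_derive_prof_g L r : 0 < L -> 0 < r ->
  is_derive (prof_g L) r (prof_k L r / r).
Proof.
  intros HL Hr; unfold prof_g, prof_k.
  auto_derive.
  - repeat split; trivial; try lra; eexists; [apply is_derive_eta | apply is_derive_eta1].
  - rewrite (is_derive_unique (fun x : R => eta x) _ _ (is_derive_eta _)),
      (is_derive_unique (fun x : R => eta1 x) _ _ (is_derive_eta1 _)).
    unfold Rdiv; field; lra.
Qed.

Lemma ln_over_le L r : 0 < L -> r <= exp L -> ln r / L <= 1.
Proof.
  intros HL Hr.
  apply (Rmult_le_reg_r L); [exact HL |].
  replace (ln r / L * L) with (ln r) by (field; lra).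
  destruct (Rle_dec r 0) as [H0 | H0].
  - unfold ln; destruct (Rlt_dec 0 r); [exfalso |]; lra.
  - rewrite Rmult_1_l, <- (ln_exp L); destruct (Req_dec r (exp L)) as [-> | Hne]; [lra |].
    left; apply ln_increasing; lra.
Qed.

Lemma ln_over_ge L r : 0 < L -> exp (2 * L) <= r -> 2 <= ln r / L.
Proof.
  intros HL Hr.
  apply (Rmult_le_reg_r L); [exact HL |].
  replace (ln r / L * L) with (ln r) by (field; lra).
  rewrite <- (ln_exp (2 * L)); destruct (Req_dec r (exp (2 * L))) as [-> | Hne]; [lra |].
  left; apply ln_increasing; [apply exp_pos | lra].
Qed.

Lemma prof_outside L r : 0 < L -> r <= exp L \/ exp (2 * L) <= r ->
  prof_f L r = 0 /\ prof_g L r = 0 /\ prof_k L r = 0.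
Proof.
  intros HL Hr.
  destruct (eta_outside (ln r / L)) as (E0 & E1 & E2).
  { destruct Hr; [left; now apply ln_over_le | right; now apply ln_over_ge]. }
  unfold prof_f, prof_g, prof_k; rewrite E0, E1, E2.
  repeat split; unfold Rdiv; ring.
Qed.

(** Uniform bounds on the whole line: the profiles vanish for [r <= 1], so that
    the division by [r] is harmless. *)
Lemma prof_bounded L : 1 <= L -> exists K, 0 <= K /\
  forall r, Rabs (prof_f L r) <= K /\ Rabs (prof_g L r) <= K /\ Rabs (prof_k L r) <= K.
Proof.
  intros HL.
  destruct eta_bounded as (K & HK & HKb).
  exists (2 * K); split; [lra |]; intros r.
  destruct (Rle_dec r 1) as [Hr | Hr].
  { destruct (prof_outside L r) as (-> & -> & ->); [lra | left |].
    - pose proof (exp_ineq1_le L); lra.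
    - rewrite Rabs_R0; lra. }
  assert (Hd : forall z, Rabs z <= 2 * K -> Rabs (z / r) <= 2 * K).
  { intros z Hz; unfold Rdiv; rewrite Rabs_mult, Rabs_inv, (Rabs_right r) by lra.
    assert (H1 : / r <= 1) by (rewrite <- Rinv_1; apply Rinv_le_contravar; lra).
    pose proof (Rabs_pos z). assert (0 < / r) by (apply Rinv_0_lt_compat; lra). nra. }
  assert (Hdiv : forall z M, 1 <= M -> Rabs z <= K -> Rabs (z / M) <= K).
  { intros z M HM Hz; unfold Rdiv; rewrite Rabs_mult, Rabs_inv, (Rabs_right M) by lra.
    assert (H1 : / M <= 1) by (rewrite <- Rinv_1; apply Rinv_le_contravar; lra).
    pose proof (Rabs_pos z). assert (0 < / M) by (apply Rinv_0_lt_compat; lra). nra. }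
  destruct (HKb (ln r / L)) as (B0 & B1 & B2).
  apply Hdiv with (M := L) in B1; [| exact HL].
  apply Hdiv with (M := L ^ 2) in B2; [| nra].
  unfold prof_f, prof_g, prof_k; split; [| split]; apply Hd.
  - lra.
  - apply Rle_trans with (1 := Rabs_triang _ _); lra.
  - apply Rle_trans with (1 := Rabs_triang _ _); rewrite Rabs_Ropp; lra.
Qed.

(** * Stability properties of the class of smooth functions *)

Section SmoothSlab.

Variable eps : R.
Notation sm := (smooth3 (half_slab eps)).

Lemma smooth3_opp f : sm f -> sm (fun t r s => - f t r s).
Proof.
  intros H; apply (smooth3_ext _ (fun t r s => (-1) * f t r s)); [intros; ring |].
  apply smooth3_mult; [apply smooth3_const | exact H].
Qed.

Lemma smooth3_minus f g : sm f -> sm g -> sm (fun t r s => f t r s - g t r s).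
Proof. intros; apply smooth3_plus; [assumption | now apply smooth3_opp]. Qed.

Lemma smooth3_div f g : sm f -> sm g ->
  (forall t r s, half_slab eps t r s -> 0 < g t r s) -> sm (fun t r s => f t r s / g t r s).
Proof.
  intros Hf Hg Hp; apply smooth3_mult; [exact Hf |].
  exact (smooth3_comp _ _ Rinv _ smooth1_inv Hp Hg).
Qed.

Lemma smooth3_sqrt f : sm f ->
  (forall t r s, half_slab eps t r s -> 0 < f t r s) -> sm (fun t r s => sqrt (f t r s)).
Proof. intros Hf Hp; exact (smooth3_comp _ _ sqrt _ smooth1_sqrt Hp Hf). Qed.

Lemma smooth3_cos f : sm f -> sm (fun t r s => cos (f t r s)).
Proof. intros Hf; apply (smooth3_comp _ _ cos _ (proj1 smooth1_trig)); trivial. Qed.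

Lemma smooth3_sin f : sm f -> sm (fun t r s => sin (f t r s)).
Proof. intros Hf; apply (smooth3_comp _ _ sin _ (proj2 smooth1_trig)); trivial. Qed.

Lemma smooth3_expinv m f : sm f -> sm (fun t r s => expinv m (f t r s)).
Proof. intros Hf; apply (smooth3_comp _ _ _ _ (smooth1_expinv m)); trivial. Qed.

Lemma smooth3_pow f n : sm f -> sm (fun t r s => f t r s ^ n).
Proof.
  intros Hf; induction n as [| n IH]; simpl; [apply smooth3_const |].
  now apply smooth3_mult.
Qed.

Lemma smooth3_ln_r L : sm (fun _ r _ => ln r / L).
Proof.
  apply smooth3_mult; [| apply smooth3_const].
  apply (smooth3_comp _ _ ln _ smooth1_ln); [| apply smooth3_r].
  intros t r s H; apply H.
Qed.

Lemma smooth3_prof L : sm (fun _ r _ => prof_f L r) /\ sm (fun _ r _ => prof_g L r) /\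
  sm (fun _ r _ => prof_k L r).
Proof.
  pose proof (smooth3_ln_r L) as Hl.
  assert (Hm : forall m, sm (fun _ r _ => expinv m (ln r / L - 1)) /\
            sm (fun _ r _ => expinv m (2 - ln r / L))).
  { intros m; split; apply smooth3_expinv, smooth3_minus;
      assumption || apply smooth3_const. }
  assert (H0 : sm (fun _ r _ => eta (ln r / L)))
    by (apply smooth3_mult; apply Hm).
  assert (H1 : sm (fun _ r _ => eta1 (ln r / L)))
    by (apply smooth3_minus; apply smooth3_mult; apply Hm).
  assert (H2 : sm (fun _ r _ => eta2 (ln r / L))).
  { unfold eta2; repeat first [apply Hm | apply smooth3_const | apply smooth3_minus
      | apply smooth3_plus | apply smooth3_mult]. }
  split; [| split]; (apply smooth3_div; [| apply smooth3_r | intros t r s H; apply H]).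
  - exact H0.
  - apply smooth3_plus; [exact H0 |]. apply smooth3_mult; [exact H1 | apply smooth3_const].
  - apply smooth3_minus; [| exact H0]. apply smooth3_mult; [exact H2 | apply smooth3_const].
Qed.

End SmoothSlab.

(** * The variation *)

(** With [x = ln r]: the relative change [u = 2 nu f sin (nu s)] of the squared
    radii, the angular shift [h = g cos (nu s)], and the derivatives [b = h_s],
    [y = u_s / 2], [w = h_x].  The relation [g = 2 f + f_x] gives
    [u_x + 2 u + 2 h_s = 0], which is the lagrangian condition. *)
Definition coef_u (nu L r s : R) : R := 2 * nu * prof_f L r * sin (nu * s).
Definition coef_h (nu L r s : R) : R := prof_g L r * cos (nu * s).
Definition coef_b (nu L r s : R) : R := - (nu * prof_g L r * sin (nu * s)).
Definition coef_y (nu L r s : R) : R := nu ^ 2 * prof_f L r * cos (nu * s).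
Definition coef_w (nu L r s : R) : R := prof_k L r * cos (nu * s).

(** For [|t| < eps] the four quantities entering the density are so small that
    the radii and the density stay positive. *)
Definition small_parameter (nu L eps : R) : Prop :=
  forall t r s, - eps < t < eps ->
  -1/4 < t * coef_u nu L r s < 1/4 /\ -1/4 < t * coef_b nu L r s < 1/4 /\
  -1/4 < t * coef_y nu L r s < 1/4 /\ -1/4 < t * coef_w nu L r s < 1/4.

(** The deformed cone: the squared radii of the cone are multiplied by
    [1 + t coef_u] and [1 - t coef_u], and [s] is shifted by [t coef_h] in the
    first angle and by [- t coef_h] in the second. *)
Definition variation (P Q nu L t r s : R) : C2 :=
  (Cmult (RtoC (/ sqrt (P + Q) * (r * sqrt Q) * sqrt (1 + t * coef_u nu L r s)))
     (cis (sqrt (P / Q) * (s + t * coef_h nu L r s))),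
   Cmult (RtoC (/ sqrt (P + Q) * (r * sqrt P) * sqrt (1 - t * coef_u nu L r s)))
     (Cmult Ci (cis (- (sqrt (Q / P) * (s - t * coef_h nu L r s)))))).

Lemma coef_derive_r nu L t r s : 0 < L -> 0 < r ->
  is_derive (fun r => t * coef_u nu L r s) r
    (- 2 * (t * coef_b nu L r s + t * coef_u nu L r s) / r) /\
  is_derive (fun r => t * coef_h nu L r s) r (t * coef_w nu L r s / r).
Proof.
  intros HL Hr.
  pose proof (is_derive_prof_f L r HL Hr) as Hf; pose proof (is_derive_prof_g L r HL Hr) as Hg.
  unfold coef_u, coef_h, coef_b, coef_w; split; auto_derive.
  - eexists; exact Hf.
  - rewrite (is_derive_unique (fun x : R => prof_f L x) _ _ Hf); field; lra.
  - eexists; exact Hg.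
  - rewrite (is_derive_unique (fun x : R => prof_g L x) _ _ Hg); field; lra.
Qed.

Lemma coef_derive_s nu L t r s :
  is_derive (fun s => t * coef_u nu L r s) s (2 * (t * coef_y nu L r s)) /\
  is_derive (fun s => t * coef_h nu L r s) s (t * coef_b nu L r s).
Proof. unfold coef_u, coef_h, coef_b, coef_y; split; auto_derive; trivial; ring. Qed.

Lemma is_derive_radius (A q : R) (V : R -> R) (r dV : R) :
  is_derive V r dV -> 0 < V r ->
  is_derive (fun r => A * (r * q) * sqrt (V r)) r
    (A * q * (V r + r * dV / 2) / sqrt (V r)).
Proof.
  intros HV Hp.
  assert (Hs : 0 < sqrt (V r)) by now apply sqrt_lt_R0.
  assert (E : Derive (fun x : R => V x) r = dV) by exact (is_derive_unique _ _ _ HV).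
  auto_derive; [repeat split; trivial; eexists; exact HV |].
  assert (Ev : V r = sqrt (V r) * sqrt (V r)) by (symmetry; apply sqrt_sqrt; lra).
  rewrite E; generalize dependent (sqrt (V r)); intros h Hs Ev.
  rewrite Ev; field; lra.
Qed.

Lemma is_derive_radius_s (A : R) (V : R -> R) (s dV : R) :
  is_derive V s dV -> 0 < V s ->
  is_derive (fun s => A * sqrt (V s)) s (A * dV / (2 * sqrt (V s))).
Proof.
  intros HV Hp.
  assert (Hs : 0 < sqrt (V s)) by now apply sqrt_lt_R0.
  assert (E : Derive (fun x : R => V x) s = dV) by exact (is_derive_unique _ _ _ HV).
  auto_derive; [repeat split; trivial; eexists; exact HV |].
  rewrite E; field; lra.
Qed.

Section Variation.

Variables (P Q nu L eps : R).
Hypotheses (HP : 0 < P) (HQ : 0 < Q) (HL : 0 < L).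
Hypothesis Hsmall : small_parameter nu L eps.

Lemma variation_d_r t r s : - eps < t < eps -> 0 < r ->
  let u := t * coef_u nu L r s in let b := t * coef_b nu L r s in
  let h := t * coef_h nu L r s in let w := t * coef_w nu L r s in
  d_r (variation P Q nu L t) r s =
  polar_tangent (/ sqrt (P + Q) * (r * sqrt Q) * sqrt (1 + u)) (sqrt (P / Q) * (s + h))
    (/ sqrt (P + Q) * (r * sqrt P) * sqrt (1 - u)) (- (sqrt (Q / P) * (s - h)))
    (/ sqrt (P + Q) * sqrt Q * (1 - b) / sqrt (1 + u)) (sqrt (P / Q) * w / r)
    (/ sqrt (P + Q) * sqrt P * (1 + b) / sqrt (1 - u)) (sqrt (Q / P) * w / r).
Proof.
  intros Ht Hr u b h w.
  destruct (Hsmall t r s Ht) as (Hu & _).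
  destruct (coef_derive_r nu L t r s HL Hr) as (Du & Dh).
  unfold d_r, variation.
  apply (Derive_C2_polar
    (fun r => / sqrt (P + Q) * (r * sqrt Q) * sqrt (1 + t * coef_u nu L r s))
    (fun r => sqrt (P / Q) * (s + t * coef_h nu L r s))
    (fun r => / sqrt (P + Q) * (r * sqrt P) * sqrt (1 - t * coef_u nu L r s))
    (fun r => - (sqrt (Q / P) * (s - t * coef_h nu L r s)))).
  - replace (/ sqrt (P + Q) * sqrt Q * (1 - b) / sqrt (1 + u)) with
      (/ sqrt (P + Q) * sqrt Q * ((1 + u) + r * (0 + (- 2 * (b + u) / r)) / 2) / sqrt (1 + u))
      by (unfold Rdiv; f_equal; f_equal; field; lra).
    apply (is_derive_radius _ _ (fun r => 1 + t * coef_u nu L r s)); [| unfold u in *; lra].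
    apply @is_derive_plus; [apply @is_derive_const | exact Du].
  - replace (sqrt (P / Q) * w / r) with (sqrt (P / Q) * (0 + w / r)) by (field; lra).
    apply @is_derive_scal, @is_derive_plus; [apply @is_derive_const | exact Dh].
  - replace (/ sqrt (P + Q) * sqrt P * (1 + b) / sqrt (1 - u)) with
      (/ sqrt (P + Q) * sqrt P * ((1 - u) + r * (0 - (- 2 * (b + u) / r)) / 2) / sqrt (1 - u))
      by (unfold Rdiv; f_equal; f_equal; field; lra).
    apply (is_derive_radius _ _ (fun r => 1 - t * coef_u nu L r s)); [| unfold u in *; lra].
    apply @is_derive_minus; [apply @is_derive_const | exact Du].
  - replace (sqrt (Q / P) * w / r) with (- (sqrt (Q / P) * (0 - w / r))) by (field; lra).
    apply @is_derive_opp, @is_derive_scal, @is_derive_minus;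
      [apply @is_derive_const | exact Dh].
Qed.

Lemma variation_d_s t r s : - eps < t < eps -> 0 < r ->
  let u := t * coef_u nu L r s in let b := t * coef_b nu L r s in
  let h := t * coef_h nu L r s in let y := t * coef_y nu L r s in
  d_s (variation P Q nu L t) r s =
  polar_tangent (/ sqrt (P + Q) * (r * sqrt Q) * sqrt (1 + u)) (sqrt (P / Q) * (s + h))
    (/ sqrt (P + Q) * (r * sqrt P) * sqrt (1 - u)) (- (sqrt (Q / P) * (s - h)))
    (/ sqrt (P + Q) * (r * sqrt Q) * y / sqrt (1 + u)) (sqrt (P / Q) * (1 + b))
    (- (/ sqrt (P + Q) * (r * sqrt P) * y / sqrt (1 - u))) (- (sqrt (Q / P) * (1 - b))).
Proof.
  intros Ht Hr u b h y.
  destruct (Hsmall t r s Ht) as (Hu & _).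
  destruct (coef_derive_s nu L t r s) as (Du & Dh).
  assert (Hp : sqrt (1 + u) <> 0) by (apply Rgt_not_eq, sqrt_lt_R0; unfold u in *; lra).
  assert (Hm : sqrt (1 - u) <> 0) by (apply Rgt_not_eq, sqrt_lt_R0; unfold u in *; lra).
  assert (Hn : sqrt (P + Q) <> 0) by (apply Rgt_not_eq, sqrt_lt_R0; lra).
  unfold d_s, variation.
  apply (Derive_C2_polar
    (fun s => / sqrt (P + Q) * (r * sqrt Q) * sqrt (1 + t * coef_u nu L r s))
    (fun s => sqrt (P / Q) * (s + t * coef_h nu L r s))
    (fun s => / sqrt (P + Q) * (r * sqrt P) * sqrt (1 - t * coef_u nu L r s))
    (fun s => - (sqrt (Q / P) * (s - t * coef_h nu L r s)))).
  - replace (/ sqrt (P + Q) * (r * sqrt Q) * y / sqrt (1 + u)) with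
      (/ sqrt (P + Q) * (r * sqrt Q) * (0 + 2 * y) / (2 * sqrt (1 + u))) by (field; auto).
    apply (is_derive_radius_s _ (fun s => 1 + t * coef_u nu L r s)); [| unfold u in *; lra].
    apply @is_derive_plus; [apply @is_derive_const | exact Du].
  - apply @is_derive_scal, @is_derive_plus; [apply @is_derive_id | exact Dh].
  - replace (- (/ sqrt (P + Q) * (r * sqrt P) * y / sqrt (1 - u))) with
      (/ sqrt (P + Q) * (r * sqrt P) * (0 - 2 * y) / (2 * sqrt (1 - u))) by (field; auto).
    apply (is_derive_radius_s _ (fun s => 1 - t * coef_u nu L r s)); [| unfold u in *; lra].
    apply @is_derive_minus; [apply @is_derive_const | exact Du].
  - apply @is_derive_opp, @is_derive_scal, @is_derive_minus; [apply @is_derive_id | exact Dh].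
Qed.

Lemma variation_lagrangian t r s : - eps < t < eps -> 0 < r ->
  lagrangian_at (variation P Q nu L t) r s.
Proof.
  intros Ht Hr; unfold lagrangian_at.
  rewrite variation_d_r, variation_d_s, omega_polar_tangent by assumption.
  destruct (Hsmall t r s Ht) as (Hu & _).
  rewrite !sqrt_div_alt by lra.
  assert (0 < sqrt P) by now apply sqrt_lt_R0.
  assert (0 < sqrt Q) by now apply sqrt_lt_R0.
  assert (0 < sqrt (P + Q)) by (apply sqrt_lt_R0; lra).
  assert (0 < sqrt (1 + t * coef_u nu L r s)) by (apply sqrt_lt_R0; lra).
  assert (0 < sqrt (1 - t * coef_u nu L r s)) by (apply sqrt_lt_R0; lra).
  field; lra.
Qed.

(** The surface being parametrised by [r] and not by [ln r], the density gets the
    factor [r ^ 2]. *)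
Lemma variation_gram t r s : - eps < t < eps -> 0 < r ->
  gram (variation P Q nu L t) r s =
  r ^ 2 * density_line (Q / (P + Q)) (P / (P + Q)) (coef_u nu L r s) (coef_b nu L r s)
            (coef_y nu L r s) (coef_w nu L r s) t.
Proof.
  intros Ht Hr; unfold gram, density_line.
  rewrite variation_d_r, variation_d_s, !inner_polar_tangent by assumption.
  destruct (Hsmall t r s Ht) as (Hu & _).
  rewrite <- density_gram; [| field; lra | lra | lra].
  rewrite !sqrt_div_alt by lra.
  assert (Ha : 0 < sqrt P) by now apply sqrt_lt_R0.
  assert (Hb : 0 < sqrt Q) by now apply sqrt_lt_R0.
  assert (Hn : 0 < sqrt (P + Q)) by (apply sqrt_lt_R0; lra).
  set (u := t * coef_u nu L r s) in *; set (b := t * coef_b nu L r s).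
  set (y := t * coef_y nu L r s); set (w := t * coef_w nu L r s).
  assert (Hp : 0 < sqrt (1 + u)) by (apply sqrt_lt_R0; lra).
  assert (Hm : 0 < sqrt (1 - u)) by (apply sqrt_lt_R0; lra).
  assert (Ea : P = sqrt P * sqrt P) by (symmetry; apply sqrt_sqrt; lra).
  assert (Eb : Q = sqrt Q * sqrt Q) by (symmetry; apply sqrt_sqrt; lra).
  assert (En : P + Q = sqrt (P + Q) * sqrt (P + Q)) by (symmetry; apply sqrt_sqrt; lra).
  assert (Ep : 1 + u = sqrt (1 + u) * sqrt (1 + u)) by (symmetry; apply sqrt_sqrt; lra).
  assert (Em : 1 - u = sqrt (1 - u) * sqrt (1 - u)) by (symmetry; apply sqrt_sqrt; lra).
  assert (C1 : Q / (P + Q) = sqrt Q * sqrt Q / (sqrt (P + Q) * sqrt (P + Q))) by now rewrite <- Eb, <- En.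
  assert (C2 : P / (P + Q) = sqrt P * sqrt P / (sqrt (P + Q) * sqrt (P + Q))) by now rewrite <- Ea, <- En.
  rewrite C1, C2.
  generalize dependent (sqrt (1 + u)); intros p1 Hp Ep.
  generalize dependent (sqrt (1 - u)); intros m1 Hm Em.
  rewrite Ep, Em.
  generalize dependent (sqrt (P + Q)); intros n Hn En _ _.
  generalize dependent (sqrt P); intros a Ha _.
  generalize dependent (sqrt Q); intros q Hb _.
  field; lra.
Qed.

Lemma variation_density_pos t r s : - eps < t < eps ->
  0 < density_line (Q / (P + Q)) (P / (P + Q)) (coef_u nu L r s) (coef_b nu L r s)
        (coef_y nu L r s) (coef_w nu L r s) t.
Proof.
  intros Ht; destruct (Hsmall t r s Ht) as (Hu & Hb & Hy & Hw).
  apply density_pos; trivial; apply Rdiv_lt_0_compat; lra.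
Qed.

Lemma coef_smooth :
  smooth3 (half_slab eps) (fun _ r s => coef_u nu L r s) /\
  smooth3 (half_slab eps) (fun _ r s => coef_h nu L r s) /\
  smooth3 (half_slab eps) (fun _ r s => coef_b nu L r s) /\
  smooth3 (half_slab eps) (fun _ r s => coef_y nu L r s) /\
  smooth3 (half_slab eps) (fun _ r s => coef_w nu L r s).
Proof.
  destruct (smooth3_prof eps L) as (Hf & Hg & Hk).
  assert (Hsin : smooth3 (half_slab eps) (fun _ _ s => sin (nu * s)))
    by (apply smooth3_sin, smooth3_mult; [apply smooth3_const | apply smooth3_s]).
  assert (Hcos : smooth3 (half_slab eps) (fun _ _ s => cos (nu * s)))
    by (apply smooth3_cos, smooth3_mult; [apply smooth3_const | apply smooth3_s]).
  unfold coef_u, coef_h, coef_b, coef_y, coef_w.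
  split; [| split; [| split; [| split]]];
    repeat first [exact Hf | exact Hg | exact Hk | exact Hsin | exact Hcos
      | apply smooth3_opp | apply smooth3_const | apply smooth3_mult].
Qed.

Lemma variation_smooth : smooth_on (half_slab eps) (variation P Q nu L).
Proof.
  destruct coef_smooth as (Su & Sh & _).
  assert (Hp : smooth3 (half_slab eps) (fun t r s => sqrt (1 + t * coef_u nu L r s))).
  { apply smooth3_sqrt.
    - apply smooth3_plus; [apply smooth3_const | apply smooth3_mult; [apply smooth3_t | exact Su]].
    - intros t r s [Ht _]; destruct (Hsmall t r s Ht); lra. }
  assert (Hm : smooth3 (half_slab eps) (fun t r s => sqrt (1 - t * coef_u nu L r s))).
  { apply smooth3_sqrt.
    - apply smooth3_minus; [apply smooth3_const | apply smooth3_mult; [apply smooth3_t | exact Su]].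
    - intros t r s [Ht _]; destruct (Hsmall t r s Ht); lra. }
  assert (H1 : smooth3 (half_slab eps) (fun t r s => sqrt (P / Q) * (s + t * coef_h nu L r s))).
  { apply smooth3_mult; [apply smooth3_const |].
    apply smooth3_plus; [apply smooth3_s | apply smooth3_mult; [apply smooth3_t | exact Sh]]. }
  assert (H2 : smooth3 (half_slab eps) (fun t r s => - (sqrt (Q / P) * (s - t * coef_h nu L r s)))).
  { apply smooth3_opp, smooth3_mult; [apply smooth3_const |].
    apply smooth3_minus; [apply smooth3_s | apply smooth3_mult; [apply smooth3_t | exact Sh]]. }
  intros n; unfold variation; simpl.
  split; [| split; [| split]]; apply smooth3_Cn; try apply half_slab_open;
    repeat first [exact Hp | exact Hm | apply (smooth3_cos eps _ H1) | apply (smooth3_sin eps _ H1)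
      | apply (smooth3_cos eps _ H2) | apply (smooth3_sin eps _ H2)
      | apply smooth3_const | apply smooth3_r | apply smooth3_minus | apply smooth3_plus
      | apply smooth3_mult].
Qed.

Lemma variation_density_smooth : smooth3 (half_slab eps)
  (fun t r s => r * sqrt (density_line (Q / (P + Q)) (P / (P + Q)) (coef_u nu L r s)
     (coef_b nu L r s) (coef_y nu L r s) (coef_w nu L r s) t)).
Proof.
  destruct coef_smooth as (Su & _ & Sb & Sy & Sw).
  apply smooth3_mult; [apply smooth3_r |].
  apply smooth3_sqrt.
  - unfold density_line, density, density_num.
    apply smooth3_div;
      [repeat first [exact Su | exact Sb | exact Sy | exact Sw | apply smooth3_const
         | apply smooth3_t | apply smooth3_pow | apply smooth3_minus | apply smooth3_plus
         | apply smooth3_mult] .. |].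
    intros t r s [Ht _]; destruct (Hsmall t r s Ht) as (Hu & _).
    apply Rmult_lt_0_compat; lra.
  - intros t r s [Ht _]; now apply variation_density_pos.
Qed.

End Variation.

(** * The sign of the second variation *)

(** The coefficients of [sin (nu s) ^ 2] and [cos (nu s) ^ 2] in the quadratic
    part of the density of the deformed cone. *)
Definition quad_sin (nu L r : R) : R :=
  nu ^ 2 * (prof_g L r ^ 2 - 4 * prof_f L r * prof_g L r + 2 * prof_f L r ^ 2).

Definition quad_cos (c1 c2 nu L r : R) : R :=
  nu ^ 2 * prof_f L r * prof_k L r
  + 2 * c1 * c2 * (prof_k L r - nu ^ 2 * prof_f L r) ^ 2.

Lemma density_quad_modes c1 c2 nu L r s :
  density_quad c1 c2 (coef_u nu L r s) (coef_b nu L r s) (coef_y nu L r s) (coef_w nu L r s)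
  = quad_sin nu L r * sin (nu * s) ^ 2 + quad_cos c1 c2 nu L r * cos (nu * s) ^ 2.
Proof.
  unfold density_quad, coef_u, coef_b, coef_y, coef_w, quad_sin, quad_cos. field.
Qed.

(** The second variation integrand in the variable [y = ln r / L], after removal
    of the exact derivative [radial_primitive'].  The factor of [eta y ^ 2] is
    negative for the modes [nu] of [unstable_mode]. *)
Definition radial_energy (K nu L y : R) : R :=
  (K * (1 + nu ^ 2) ^ 2 - 2 * nu ^ 2) * eta y ^ 2
  + 2 * K * (1 + nu ^ 2) / L ^ 2 * eta1 y ^ 2 + K / L ^ 4 * eta2 y ^ 2.

Definition radial_primitive (K nu L y : R) : R :=
  - nu ^ 2 / L * eta y ^ 2 + (nu ^ 2 - 2 * K * (1 + nu ^ 2)) / L ^ 2 * (eta y * eta1 y).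

Definition radial_primitive' (K nu L y : R) : R :=
  - 2 * nu ^ 2 / L * (eta y * eta1 y)
  + (nu ^ 2 - 2 * K * (1 + nu ^ 2)) / L ^ 2 * (eta1 y ^ 2 + eta y * eta2 y).

Lemma is_derive_radial_primitive K nu L y : 0 < L ->
  is_derive (radial_primitive K nu L) y (radial_primitive' K nu L y).
Proof.
  intros HL; unfold radial_primitive, radial_primitive'.
  pose proof (is_derive_eta y) as H0; pose proof (is_derive_eta1 y) as H1.
  auto_derive; [repeat split; trivial; eexists; eassumption |].
  rewrite (is_derive_unique (fun x : R => eta x) _ _ H0),
    (is_derive_unique (fun x : R => eta1 x) _ _ H1); field; lra.
Qed.

Lemma radial_identity c1 c2 nu L r : 0 < L -> 0 < r ->
  2 * r * (quad_sin nu L r + quad_cos c1 c2 nu L r)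
  = 2 / r * (radial_energy (2 * c1 * c2) nu L (ln r / L)
             + radial_primitive' (2 * c1 * c2) nu L (ln r / L)).
Proof.
  intros HL Hr.
  unfold quad_sin, quad_cos, radial_energy, radial_primitive', prof_f, prof_g, prof_k.
  field; lra.
Qed.

Lemma continuous_radial K nu L y :
  continuous (radial_energy K nu L) y /\ continuous (radial_primitive' K nu L) y.
Proof.
  pose proof (continuous_eta y) as H0.
  pose proof (continuous_eta1 y) as H1.
  pose proof (continuous_eta2 y) as H2.
  assert (Hm : forall f g : R -> R, continuous f y -> continuous g y ->
            continuous (fun x => f x * g x) y) by (intros; now apply @continuous_mult).
  assert (Hp : forall f g : R -> R, continuous f y -> continuous g y ->
            continuous (fun x => f x + g x) y) by (intros; now apply @continuous_plus).
  assert (Hc : forall (c : R) (f : R -> R), continuous f y -> continuous (fun x => c * f x) y)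
    by (intros; apply Hm; [apply continuous_const | assumption]).
  assert (H2m : forall f : R -> R, continuous f y -> continuous (fun x => f x ^ 2) y).
  { intros f Hf; simpl; apply Hm; [exact Hf |].
    apply Hm; [exact Hf | apply continuous_const]. }
  unfold radial_energy, radial_primitive'; split.
  - apply Hp; [apply Hp |]; apply Hc, H2m; assumption.
  - apply Hp; apply Hc; [now apply Hm |].
    apply Hp; [now apply H2m | now apply Hm].
Qed.

(** The derivative of [radial_primitive] integrates to zero because [eta] vanishes
    at both ends of [[1, 2]]. *)
Lemma radial_RInt c1 c2 nu L : 0 < L ->
  is_RInt (fun r => 2 * r * (quad_sin nu L r + quad_cos c1 c2 nu L r)) (exp L) (exp (2 * L))
    (2 * L * RInt (radial_energy (2 * c1 * c2) nu L) 1 2).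
Proof.
  intros HL; set (K := 2 * c1 * c2).
  assert (Hlt : exp L < exp (2 * L)) by (apply exp_increasing; lra).
  pose proof (exp_pos L) as Hpos.
  pose (h := fun y => radial_energy K nu L y + radial_primitive' K nu L y).
  assert (Hh : forall y, continuous h y)
    by (intros; apply @continuous_plus;
        apply continuous_radial).
  assert (I1 : is_RInt h 1 2 (RInt (radial_energy K nu L) 1 2)).
  { replace (RInt (radial_energy K nu L) 1 2) with
      (RInt (radial_energy K nu L) 1 2
       + (radial_primitive K nu L 2 - radial_primitive K nu L 1)).
    - apply @is_RInt_plus.
      + apply @RInt_correct, @ex_RInt_continuous; intros; apply continuous_radial.
      + apply @is_RInt_derive; intros;
          [now apply is_derive_radial_primitive | apply continuous_radial].
    - unfold radial_primitive.
      destruct (eta_outside 1) as (-> & -> & _); [lra |].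
      destruct (eta_outside 2) as (-> & -> & _); [lra |].
      ring. }
  assert (Hln : forall r, exp L <= r <= exp (2 * L) -> is_derive (fun r => ln r / L) r (/ (L * r))).
  { intros r Hr; auto_derive; [lra | field; lra]. }
  assert (I2 : is_RInt (fun r => scal (/ (L * r)) (h (ln r / L))) (exp L) (exp (2 * L))
                 (RInt h (ln (exp L) / L) (ln (exp (2 * L)) / L))).
  { apply (is_RInt_comp h (fun r => ln r / L) (fun r => / (L * r))); rewrite Rmin_left, Rmax_right by lra; intros r Hr; [apply Hh |].
    split; [now apply Hln |].
    apply @ex_derive_continuous; auto_derive; nra. }
  rewrite !ln_exp in I2.
  replace (L / L) with 1 in I2 by (field; lra).
  replace (2 * L / L) with 2 in I2 by (field; lra).
  rewrite (is_RInt_unique _ _ _ _ I1) in I2.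
  apply (is_RInt_scal _ _ _ (2 * L)) in I2.
  refine (is_RInt_ext _ _ _ _ _ _ I2).
  rewrite Rmin_left, Rmax_right by lra; intros r Hr.
  rewrite radial_identity by lra.
  fold K; change (h (ln r / L)) with
    (radial_energy K nu L (ln r / L) + radial_primitive' K nu L (ln r / L)).
  change (2 * L * (/ (L * r) * (radial_energy K nu L (ln r / L)
      + radial_primitive' K nu L (ln r / L))) =
    2 / r * (radial_energy K nu L (ln r / L) + radial_primitive' K nu L (ln r / L))).
  field; lra.
Qed.

(** The two terms of the energy containing derivatives of [eta] carry negative
    powers of [L], so the first one dominates for [L] large. *)
Lemma radial_energy_neg K nu : 0 < K -> K * (1 + nu ^ 2) ^ 2 < 2 * nu ^ 2 ->
  exists L, 1 <= L /\ RInt (radial_energy K nu L) 1 2 < 0.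
Proof.
  intros HK HM.
  assert (C : forall g : R -> R, (forall y, continuous g y) ->
            ex_RInt (fun y => g y ^ 2) 1 2).
  { intros g Hg; apply @ex_RInt_continuous; intros y _; simpl.
    repeat (apply @continuous_mult; [apply Hg |]); apply continuous_const. }
  pose proof (C _ continuous_eta) as E0; pose proof (C _ continuous_eta1) as E1;
    pose proof (C _ continuous_eta2) as E2.
  set (A0 := RInt (fun y => eta y ^ 2) 1 2).
  set (A1 := RInt (fun y => eta1 y ^ 2) 1 2).
  set (A2 := RInt (fun y => eta2 y ^ 2) 1 2).
  assert (P0 : 0 < A0).
  { apply RInt_gt_0; [lra | intros y Hy; apply pow_lt, eta_pos, Hy |].
    intros y _; simpl; repeat (apply @continuous_mult; [apply continuous_eta |]);
      apply continuous_const. }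
  assert (P1 : 0 <= A1) by (apply RInt_ge_0; [lra | exact E1 | intros; apply pow2_ge_0]).
  assert (P2 : 0 <= A2) by (apply RInt_ge_0; [lra | exact E2 | intros; apply pow2_ge_0]).
  set (M := 2 * nu ^ 2 - K * (1 + nu ^ 2) ^ 2).
  assert (HMp : 0 < M) by (unfold M; lra).
  set (X := 2 * K * (1 + nu ^ 2) * A1 + K * A2).
  assert (HX : 0 <= X).
  { pose proof (pow2_ge_0 nu); unfold X.
    apply Rplus_le_le_0_compat; repeat apply Rmult_le_pos; lra. }
  assert (HMA : 0 < M * A0) by now apply Rmult_lt_0_compat.
  (* M A0 is the size of the negative term; the other two are at most X / L^2 *)
  set (L := 1 + X / (M * A0)).
  assert (HXM : 0 <= X / (M * A0)) by now apply Rdiv_le_0_compat.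
  assert (HL : 1 <= L) by (unfold L; lra).
  exists L; split; [exact HL |].
  assert (I : is_RInt (radial_energy K nu L) 1 2
     ((K * (1 + nu ^ 2) ^ 2 - 2 * nu ^ 2) * A0
      + 2 * K * (1 + nu ^ 2) / L ^ 2 * A1 + K / L ^ 4 * A2)).
  { apply @is_RInt_plus; [apply @is_RInt_plus |]; apply @is_RInt_scal, @RInt_correct; assumption. }
  rewrite (is_RInt_unique _ _ _ _ I).
  assert (HL2 : L <= L ^ 2) by nra.
  assert (HL4 : L ^ 2 <= L ^ 4) by (replace (L ^ 4) with (L ^ 2 * L ^ 2) by ring; nra).
  assert (H4 : K / L ^ 4 * A2 <= K / L ^ 2 * A2).
  { apply Rmult_le_compat_r; [exact P2 |]; apply Rmult_le_compat_l; [lra |].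
    apply Rinv_le_contravar; lra. }
  assert (HX2 : X / L ^ 2 < M * A0).
  { apply (Rmult_lt_reg_r (L ^ 2)); [lra |].
    replace (X / L ^ 2 * L ^ 2) with X by (field; lra).
    apply Rlt_le_trans with (M * A0 * L); [| apply Rmult_le_compat_l; lra].
    unfold L; replace (M * A0 * (1 + X / (M * A0))) with (M * A0 + X) by (field; lra). lra. }
  assert (EX : X / L ^ 2 = 2 * K * (1 + nu ^ 2) / L ^ 2 * A1 + K / L ^ 2 * A2)
    by (unfold X; field; lra).
  replace (K * (1 + nu ^ 2) ^ 2 - 2 * nu ^ 2) with (- M) by (unfold M; ring).
  lra.
Qed.

Lemma trig_square_RInt nu T c d : 0 < nu -> sin (nu * T) = 0 ->
  is_RInt (fun s => c * sin (nu * s) ^ 2 + d * cos (nu * s) ^ 2) 0 T (T / 2 * (c + d)).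
Proof.
  intros Hnu HT.
  pose (W := fun s => c * (s / 2 - sin (nu * s) * cos (nu * s) / (2 * nu))
              + d * (s / 2 + sin (nu * s) * cos (nu * s) / (2 * nu))).
  assert (E0 : W T - W 0 = T / 2 * (c + d))
    by (unfold W; rewrite HT, Rmult_0_r, sin_0; field; lra).
  rewrite <- E0; apply (is_RInt_derive W); intros s _.
  - unfold W; auto_derive; [trivial |].
      pose proof (sin2_cos2 (nu * s)) as E; unfold Rsqr in E.
      transitivity (c * sin (nu * s) ^ 2 + d * cos (nu * s) ^ 2
        + (c + d) / 2 * (1 - (sin (nu * s) * sin (nu * s) + cos (nu * s) * cos (nu * s))));
        [field; lra | rewrite E; ring].
  - apply @ex_derive_continuous; auto_derive; trivial.
Qed.

(** As [k |p - q| >= 2], some integer lies strictly between [k p] and [k q]. *)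
Lemma intermediate_mode (p q k : nat) : p <> q -> (1 < k)%nat ->
  exists m : nat, (INR m - INR k * INR p) * (INR m - INR k * INR q) < 0.
Proof.
  intros Hpq Hk.
  assert (H : forall a b : nat, (a < b)%nat ->
    (INR (k * a + 1) - INR k * INR a) * (INR (k * a + 1) - INR k * INR b) < 0).
  { intros a b Hab.
    assert (H1 : INR (k * a + 1) = INR k * INR a + 1)
      by (rewrite plus_INR, mult_INR; reflexivity).
    assert (H2 : INR (k * a + 1) < INR k * INR b)
      by (rewrite <- mult_INR; apply lt_INR; nia).
    rewrite H1 in *; nra. }
  destruct (Nat.lt_ge_cases p q) as [Hlt | Hge].
  - exists (k * p + 1)%nat; now apply H.
  - exists (k * q + 1)%nat; rewrite Rmult_comm; apply H; lia.
Qed.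

(** The factor of [eta ^ 2] is negative when [sqrt (PQ) (1 + nu^2) < (P + Q) nu],
    which says that [nu sqrt (PQ) = m / k] lies strictly between [P] and [Q]. *)
Lemma unstable_mode (P Q k m : R) : 0 < P -> 0 < Q -> 0 < k -> 0 <= m ->
  (m - k * P) * (m - k * Q) < 0 ->
  let nu := m / (k * sqrt (P * Q)) in
  let K := 2 * (Q / (P + Q)) * (P / (P + Q)) in
  K * (1 + nu ^ 2) ^ 2 < 2 * nu ^ 2.
Proof.
  intros HP HQ Hk Hm H nu K.
  assert (HPQ : 0 < P * Q) by now apply Rmult_lt_0_compat.
  assert (Hs : 0 < sqrt (P * Q)) by now apply sqrt_lt_R0.
  assert (Es : sqrt (P * Q) ^ 2 = P * Q) by (simpl; rewrite Rmult_1_r; apply sqrt_sqrt; lra).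
  assert (Hmk : m = nu * (k * sqrt (P * Q))) by (unfold nu; field; lra).
  assert (Hnu : 0 <= nu) by (unfold nu; apply Rdiv_le_0_compat; [lra | nra]).
  (* the hypothesis divided by k^2 sqrt(PQ) *)
  assert (H1 : sqrt (P * Q) * (1 + nu ^ 2) < (P + Q) * nu).
  { rewrite Hmk in H.
    apply (Rmult_lt_reg_r (k ^ 2 * sqrt (P * Q)));
      [apply Rmult_lt_0_compat; [now apply pow_lt | exact Hs] |].
    replace (sqrt (P * Q) * (1 + nu ^ 2) * (k ^ 2 * sqrt (P * Q))) with
      (k ^ 2 * (sqrt (P * Q) ^ 2 + nu ^ 2 * sqrt (P * Q) ^ 2)) by ring.
    rewrite Es at 1.
    replace ((P + Q) * nu * (k ^ 2 * sqrt (P * Q))) with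
      (k ^ 2 * ((P + Q) * nu * sqrt (P * Q))) by ring.
    nra. }
  assert (H2 : P * Q * (1 + nu ^ 2) ^ 2 < (P + Q) ^ 2 * nu ^ 2).
  { rewrite <- Es.
    replace (sqrt (P * Q) ^ 2 * (1 + nu ^ 2) ^ 2) with ((sqrt (P * Q) * (1 + nu ^ 2)) ^ 2) by ring.
    replace ((P + Q) ^ 2 * nu ^ 2) with (((P + Q) * nu) ^ 2) by ring.
    assert (0 <= sqrt (P * Q) * (1 + nu ^ 2))
      by (apply Rmult_le_pos; [lra | pose proof (pow2_ge_0 nu); lra]).
    generalize dependent (sqrt (P * Q) * (1 + nu ^ 2)); intros x Hx Hx0; nra. }
  unfold K.
  apply (Rmult_lt_reg_r ((P + Q) ^ 2 / 2)); [pose proof (pow_lt (P + Q) 2 ltac:(lra)); lra |].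
  replace (2 * (Q / (P + Q)) * (P / (P + Q)) * (1 + nu ^ 2) ^ 2 * ((P + Q) ^ 2 / 2))
    with (P * Q * (1 + nu ^ 2) ^ 2) by (field; lra).
  replace (2 * nu ^ 2 * ((P + Q) ^ 2 / 2)) with ((P + Q) ^ 2 * nu ^ 2) by field.
  exact H2.
Qed.

Lemma coef_small nu L : 0 < nu -> 1 <= L -> exists eps, 0 < eps /\ small_parameter nu L eps.
Proof.
  intros Hnu HL.
  destruct (prof_bounded L HL) as (K & HK & HKb).
  set (C := (1 + 2 * nu + nu ^ 2) * K + 1).
  assert (Hnu2 : 0 <= nu ^ 2) by apply pow2_ge_0.
  assert (HC : 1 <= C) by (unfold C; nra).
  exists (/ (4 * C)); split; [apply Rinv_0_lt_compat; lra |].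
  intros t r s Ht.
  assert (Hb : forall x, Rabs x <= C -> -1/4 < t * x < 1/4).
  { intros x Hx.
    assert (H : Rabs (t * x) < 1/4).
    { rewrite Rabs_mult.
      apply Rle_lt_trans with (Rabs t * C); [apply Rmult_le_compat_l; [apply Rabs_pos | exact Hx] |].
      replace (1/4) with (/ (4 * C) * C) by (field; lra).
      apply Rmult_lt_compat_r; [lra | apply Rabs_def1; lra]. }
    apply Rabs_def2 in H; lra. }
  assert (Hp : forall c z x, 0 <= c <= 1 + 2 * nu + nu ^ 2 -> Rabs z <= K -> Rabs x <= 1 ->
             Rabs (c * z * x) <= C).
  { intros c z x Hc Hz Hx; rewrite !Rabs_mult, (Rabs_right c) by lra.
    apply Rle_trans with ((1 + 2 * nu + nu ^ 2) * K * 1); [| unfold C; lra].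
    repeat apply Rmult_le_compat; try apply Rmult_le_pos; try apply Rabs_pos; lra. }
  assert (Hsin : Rabs (sin (nu * s)) <= 1) by (apply Rabs_le, SIN_bound).
  assert (Hcos : Rabs (cos (nu * s)) <= 1) by (apply Rabs_le, COS_bound).
  destruct (HKb r) as (Bf & Bg & Bk).
  unfold coef_u, coef_b, coef_y, coef_w; split; [| split; [| split]]; apply Hb.
  - apply Hp; trivial; lra.
  - rewrite Rabs_Ropp; apply Hp; trivial; lra.
  - apply Hp; trivial; lra.
  - replace (prof_k L r) with (1 * prof_k L r) by ring; apply Hp; trivial; lra.
Qed.

(** The hypothesis on [sin (nu * T)] makes [sin (nu s) ^ 2] and [cos (nu s) ^ 2]
    have the same mean [1 / 2] over a period. *)
Lemma variation_second_variation P Q nu L eps T :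
  0 < P -> 0 < Q -> 0 < nu -> 0 < L -> 0 < eps -> 0 <= T -> sin (nu * T) = 0 ->
  small_parameter nu L eps ->
  is_second_variation (fun t => area (variation P Q nu L t) (exp L) (exp (2 * L)) T)
    (T * L * RInt (radial_energy (2 * (Q / (P + Q)) * (P / (P + Q))) nu L) 1 2).
Proof.
  intros HP HQ Hnu HL Heps HT HsT Hsmall.
  set (c1 := Q / (P + Q)); set (c2 := P / (P + Q)).
  assert (Hlt : exp L < exp (2 * L)) by (apply exp_increasing; lra).
  pose proof (exp_pos L) as Hpos.
  assert (Hc : c1 + c2 = 1) by (unfold c1, c2; field; lra).
  pose (Phi := fun t r s => r * sqrt (density_line c1 c2 (coef_u nu L r s) (coef_b nu L r s)
     (coef_y nu L r s) (coef_w nu L r s) t)).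
  assert (SPhi : smooth3 (half_slab eps) Phi)
    by exact (variation_density_smooth P Q nu L eps HP HQ Hsmall).
  destruct (smooth3_partial _ Phi (half_slab_open eps) SPhi) as (Ft & Fr & Fs & SFt & _ & _ & DF).
  destruct (smooth3_partial _ Ft (half_slab_open eps) SFt) as (Ftt & Ftr & Fts & SFtt & _ & _ & DFt).
  pose (A := fun t => area (variation P Q nu L t) (exp L) (exp (2 * L)) T).
  pose (dbl := fun f : R -> R -> R -> R => fun t =>
     RInt (fun s => RInt (fun r => f t r s) (exp L) (exp (2 * L))) 0 T).
  assert (HA : forall t, - eps < t < eps -> A t = dbl Phi t).
  { intros t Ht; unfold A, area, dbl.
    apply RInt_ext; intros s _.
    apply RInt_ext; rewrite Rmin_left, Rmax_right by lra; intros r Hr.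
    rewrite (variation_gram P Q nu L eps) by (assumption || lra).
    rewrite sqrt_mult_alt by apply pow2_ge_0.
    rewrite sqrt_pow2 by lra. reflexivity. }
  assert (Hnear : forall t, - eps < t < eps -> locally t (fun t' => - eps < t' < eps))
    by (intros; now apply locally_parameter).
  assert (DA : forall t, - eps < t < eps -> is_derive A t (dbl Ft t)).
  { intros t Ht; apply (is_derive_ext_loc (dbl Phi)).
    - generalize (Hnear t Ht); apply filter_imp; intros; symmetry; now apply HA.
    - apply (is_derive_double_RInt eps (exp L) (exp (2 * L)) T Hpos Hlt Phi Ft t); trivial.
      intros; now apply DF. }
  assert (H0 : - eps < 0 < eps) by lra.
  split.
  - generalize (Hnear 0 H0); apply filter_imp; intros t Ht; eexists; now apply DA.
  - change (is_derive (Derive A) 0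
      (T * L * RInt (radial_energy (2 * c1 * c2) nu L) 1 2)).
    apply (is_derive_ext_loc (dbl Ft)).
    { generalize (Hnear 0 H0); apply filter_imp; intros t Ht; symmetry.
      now apply is_derive_unique, DA. }
    replace (T * L * RInt (radial_energy (2 * c1 * c2) nu L) 1 2) with (dbl Ftt 0).
    { apply (is_derive_double_RInt eps (exp L) (exp (2 * L)) T Hpos Hlt Ft Ftt 0); trivial.
      intros; now apply DFt. }
    (* at t = 0 the double t-derivative of the density is its quadratic part *)
    assert (EFtt : forall r s, 0 < r -> Ftt 0 r s =
        2 * r * (quad_sin nu L r * sin (nu * s) ^ 2 + quad_cos c1 c2 nu L r * cos (nu * s) ^ 2)).
    { intros r s Hr; rewrite <- density_quad_modes.
      destruct (density_line_derive c1 c2 (coef_u nu L r s) (coef_b nu L r s)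
         (coef_y nu L r s) (coef_w nu L r s) Hc) as (d' & Hd & Hd').
      assert (EFt : forall t, - eps < t < eps -> Ft t r s = r * d' t).
      { intros t Ht.
        pose proof (is_derive_unique _ _ _ (proj1 (DF t r s (conj Ht Hr)))) as E1.
        rewrite <- E1; apply is_derive_unique; unfold Phi; apply @is_derive_scal, Hd.
        - now apply (variation_density_pos P Q nu L eps HP HQ Hsmall).
        - destruct (Hsmall t r s Ht) as (Hu & _); apply Rmult_integral_contrapositive_currified; lra. }
      pose proof (is_derive_unique _ _ _ (proj1 (DFt 0 r s (conj H0 Hr)))) as E2.
      rewrite <- E2; apply is_derive_unique.
      apply (is_derive_ext_loc (fun t => r * d' t)).
      - generalize (Hnear 0 H0); apply filter_imp; intros t Ht; symmetry; now apply EFt.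
      - match goal with |- is_derive _ _ ?v => replace v with (r * (2 * density_quad c1 c2
          (coef_u nu L r s) (coef_b nu L r s) (coef_y nu L r s) (coef_w nu L r s))) by ring end.
        now apply @is_derive_scal. }
    assert (Cq : forall q : R -> R, smooth3 (half_slab eps) (fun _ r _ => q r) ->
              ex_RInt (fun r => 2 * r * q r) (exp L) (exp (2 * L))).
    { intros q Sq; apply (ex_RInt_inner eps (exp L) (exp (2 * L)) Hpos Hlt
        (fun _ r _ => 2 * r * q r) 0 0); [| exact H0].
      repeat apply smooth3_mult; [apply smooth3_const | apply smooth3_r | exact Sq]. }
    destruct (smooth3_prof eps L) as (Sf & Sg & Sk).
    assert (X1 : ex_RInt (fun r => 2 * r * quad_sin nu L r) (exp L) (exp (2 * L))).
    { apply Cq; unfold quad_sin.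
      repeat first [exact Sf | exact Sg | apply smooth3_const | apply smooth3_pow
        | apply smooth3_minus | apply smooth3_plus | apply smooth3_mult]. }
    assert (X2 : ex_RInt (fun r => 2 * r * quad_cos c1 c2 nu L r) (exp L) (exp (2 * L))).
    { apply Cq; unfold quad_cos.
      repeat first [exact Sf | exact Sk | apply smooth3_const | apply smooth3_pow
        | apply smooth3_minus | apply smooth3_plus | apply smooth3_mult]. }
    set (J1 := RInt (fun r => 2 * r * quad_sin nu L r) (exp L) (exp (2 * L))).
    set (J2 := RInt (fun r => 2 * r * quad_cos c1 c2 nu L r) (exp L) (exp (2 * L))).
    assert (HJ : J1 + J2 = 2 * L * RInt (radial_energy (2 * c1 * c2) nu L) 1 2).
    { rewrite <- (is_RInt_unique _ _ _ _ (radial_RInt c1 c2 nu L HL)).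
      symmetry; apply is_RInt_unique.
      apply (is_RInt_ext (fun r => 2 * r * quad_sin nu L r + 2 * r * quad_cos c1 c2 nu L r));
        [intros; symmetry; apply Rmult_plus_distr_l |].
      apply @is_RInt_plus; apply @RInt_correct; assumption. }
    replace (T * L * RInt (radial_energy (2 * c1 * c2) nu L) 1 2)
      with (T / 2 * (J1 + J2)) by (rewrite HJ; field).
    unfold dbl.
    rewrite <- (is_RInt_unique _ _ _ _ (trig_square_RInt nu T J1 J2 Hnu HsT)).
    apply RInt_ext; intros s _.
    apply is_RInt_unique.
    apply (is_RInt_ext (fun r => sin (nu * s) ^ 2 * (2 * r * quad_sin nu L r)
             + cos (nu * s) ^ 2 * (2 * r * quad_cos c1 c2 nu L r))).
    { rewrite Rmin_left, Rmax_right by lra; intros r Hr; rewrite EFtt by lra.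
      match goal with |- ?x = ?y => change (@eq R x y) end; ring. }
    rewrite (Rmult_comm J1), (Rmult_comm J2).
    apply @is_RInt_plus; apply @is_RInt_scal, @RInt_correct; assumption.
Qed.

Lemma cis_period x (n : nat) : cis (x + 2 * INR n * PI) = cis x.
Proof. unfold cis; now rewrite cos_period, sin_period. Qed.

Lemma cis_neg_period x (n : nat) : cis (x - 2 * INR n * PI) = cis x.
Proof.
  rewrite <- (cis_period (x - 2 * INR n * PI) n); f_equal; ring.
Qed.

Theorem proposition7p5 (p q k : nat)
    (hp : (0 < p)%nat) (hq : (0 < q)%nat) (hpq : Nat.gcd p q = 1%nat)
    (hne : p <> q) (hk : (1 < k)%nat) :
  strictly_unstable_away_from_vertex p q k.
Proof.
  assert (HP : 0 < INR p) by now apply lt_0_INR.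
  assert (HQ : 0 < INR q) by now apply lt_0_INR.
  assert (Hk : 0 < INR k) by (apply lt_0_INR; lia).
  destruct (intermediate_mode p q k hne hk) as (m & Hm).
  assert (Hm0 : 0 < INR m).
  { destruct m as [| m]; [| apply lt_0_INR; lia].
    simpl INR in Hm; exfalso.
    assert (0 < INR k * INR p) by now apply Rmult_lt_0_compat.
    assert (0 < INR k * INR q) by now apply Rmult_lt_0_compat.
    nra. }
  assert (HPQ : 0 < INR p * INR q) by now apply Rmult_lt_0_compat.
  assert (Hs : 0 < sqrt (INR p * INR q)) by now apply sqrt_lt_R0.
  assert (HK : 0 < 2 * (INR q / (INR p + INR q)) * (INR p / (INR p + INR q)))
    by (repeat apply Rmult_lt_0_compat; try apply Rinv_0_lt_compat; lra).
  set (P := INR p) in *; set (Q := INR q) in *.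
  pose proof (unstable_mode P Q (INR k) (INR m) HP HQ Hk (Rlt_le _ _ Hm0) Hm) as Hmode.
  cbv zeta in Hmode.
  set (nu := INR m / (INR k * sqrt (P * Q))) in *.
  assert (Hnu : 0 < nu) by (unfold nu; apply Rdiv_lt_0_compat; [lra | now apply Rmult_lt_0_compat]).
  destruct (radial_energy_neg _ nu HK Hmode) as (L & HL & Hneg).
  destruct (coef_small nu L Hnu HL) as (eps & Heps & Hsmall).
  set (T := cone_period p q k).
  assert (HT0 : 0 < T).
  { pose proof PI_RGT_0; unfold T, cone_period.
    apply Rmult_lt_0_compat; [| exact Hs].
    apply Rmult_lt_0_compat; [lra | assumption]. }
  assert (HnuT : nu * T = 2 * INR m * PI)
    by (unfold nu, T, cone_period; fold P Q; field; lra).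
  assert (HsT : sin (nu * T) = 0).
  { rewrite HnuT, <- (Rplus_0_l (2 * INR m * PI)), sin_period; apply sin_0. }
  assert (HaT : forall x, cis (sqrt (P / Q) * (x + T)) = cis (sqrt (P / Q) * x)).
  { intros x; rewrite <- (cis_period (sqrt (P / Q) * x) (k * p)); f_equal.
    rewrite mult_INR; fold P; unfold T, cone_period; fold P Q.
    rewrite sqrt_div_alt, sqrt_mult_alt by lra.
    assert (Ea : sqrt P * sqrt P = P) by (apply sqrt_sqrt; lra).
    assert (Hb : 0 < sqrt Q) by now apply sqrt_lt_R0.
    transitivity (sqrt P / sqrt Q * x + 2 * (INR k * (sqrt P * sqrt P)) * PI);
      [field; lra | now rewrite Ea]. }
  assert (HbT : forall x, cis (- (sqrt (Q / P) * (x + T))) = cis (- (sqrt (Q / P) * x))).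
  { intros x; rewrite <- (cis_neg_period (- (sqrt (Q / P) * x)) (k * q)); f_equal.
    rewrite mult_INR; fold Q; unfold T, cone_period; fold P Q.
    rewrite sqrt_div_alt, sqrt_mult_alt by lra.
    assert (Ea : sqrt Q * sqrt Q = Q) by (apply sqrt_sqrt; lra).
    assert (Hb : 0 < sqrt P) by now apply sqrt_lt_R0.
    transitivity (- (sqrt Q / sqrt P * x) - 2 * (INR k * (sqrt Q * sqrt Q)) * PI);
      [field; lra | now rewrite Ea]. }
  assert (Hfix : forall t r s, t * coef_u nu L r s = 0 -> t * coef_h nu L r s = 0 ->
             variation P Q nu L t r s = cone p q r s).
  { intros t r s Eu Eh; unfold variation, cone; rewrite Eu, Eh; fold P Q.
    rewrite !Rplus_0_r, !Rminus_0_r, sqrt_1, !Rmult_1_r; reflexivity. }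
  assert (Hout : forall t r s, r <= exp L \/ exp (2 * L) <= r ->
             variation P Q nu L t r s = cone p q r s).
  { intros t r s Hr; destruct (prof_outside L r) as (Ef & Eg & _); [lra | exact Hr |].
    apply Hfix; unfold coef_u, coef_h; rewrite ?Ef, ?Eg; ring. }
  exists eps, (exp L), (exp (2 * L)), (variation P Q nu L); split; [split |].
  - exact Heps.
  - split; [apply exp_pos | apply exp_increasing; lra].
  - exact (variation_smooth P Q nu L eps Hsmall).
  - intros t r s _ _; fold T.
    assert (Eu : coef_u nu L r (s + T) = coef_u nu L r s).
    { unfold coef_u; rewrite Rmult_plus_distr_l, HnuT, sin_period; reflexivity. }
    assert (Eh : coef_h nu L r (s + T) = coef_h nu L r s).
    { unfold coef_h; rewrite Rmult_plus_distr_l, HnuT, cos_period; reflexivity. }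
    unfold variation; rewrite Eu, Eh.
    replace (s + T + t * coef_h nu L r s) with (s + t * coef_h nu L r s + T) by ring.
    replace (s + T - t * coef_h nu L r s) with (s - t * coef_h nu L r s + T) by ring.
    now rewrite HaT, HbT.
  - intros r s _; apply Hfix; ring.
  - intros t r s _ Hr; apply Hout; lra.
  - intros t r s _ Hr; apply Hout; lra.
  - intros t r s Ht Hr; unfold immersed_at.
    rewrite (variation_gram P Q nu L eps) by (assumption || lra).
    apply Rmult_lt_0_compat; [now apply pow_lt |].
    now apply (variation_density_pos P Q nu L eps HP HQ Hsmall).
  - intros t r s Ht Hr.
    apply (variation_lagrangian P Q nu L eps); trivial; lra.
  - eexists; split.
    + apply (variation_second_variation P Q nu L eps T); trivial; lra.
    + assert (0 < T * L) by (apply Rmult_lt_0_compat; lra). nra.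
Qed.
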